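(* Assume at least one agent satisfies (M), every agent satisfying (M) is of type P or type E, and one of the following holds: (1) At least one agent is of type E, and for all $\chi(0)\in\Delta_{A-1}^o$ and $i,j\in[A]$ the two statements $\liminf_{N\to\infty}F_i(\chi_i(0)N)/F_j(\chi_j(0)N)=0$ and $\limsup_{N\to\infty}F_i(\chi_i(0)N)/F_j(\chi_j(0)N)=\infty$ do not hold simultaneously. (2) No agent is of type E, every agent of type P satisfies $\limsup_{k\to\infty}\frac1kF_i(k)\sum_{l=k}^\infty\frac1{F_i(l)}<\infty$, and $\lim_{N\to\infty}F_i(\chi_i(0)N)/F_j(\chi_j(0)N)\in[0,\infty]$ exists for all $\chi(0)\in\Delta_{A-1}^o$ and $i,j\in[A]$. Then each asymptotic attraction domain $D_i$ is, up to boundary points, a convex polytope, and these domains dissect the simplex up to boundaries: $\bigcup_{i=1}^A\overline{D_i}=\Delta_{A-1}$ (closure in $\Delta_{A-1}$). Moreover $D_i=\emptyset$ for every agent $i$ not satisfying (M).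
   Context: Fix $A\ge 2$, $[A]=\{1,\dots,A\}$, and feedback functions $F_i:\mathbb{N}\to(0,\infty)$. The generalized Pólya urn is the Markov chain $X(n)\in\mathbb{N}^A$, $n\in\mathbb{N}_0$, with $X_i(0)\ge1$ and $\mathbb{P}(X(n+1)=X(n)+e^{(i)}\mid X(n))=F_i(X_i(n))/\sum_{j}F_j(X_j(n))$. $N=\sum_iX_i(0)$; $\Delta_{A-1}=\{x\in[0,1]^A:\sum x_i=1\}$ with interior $\Delta_{A-1}^o$. For fixed $\chi(0)\in\Delta_{A-1}^o$ the process starts from $X_i(0)=\chi_i(0)N$ (rounded), and each $F_i$ is extended to a $C^1$ function on $(0,\infty)$ monotone on every $[n,n+1]$. $sMon_i(\chi(0),N)=\{\lim_{n\to\infty}\sum_{j\ne i}X_j(n)<\infty\}$. The asymptotic attraction domain of agent $i$ is $D_i=\{\chi(0)\in\Delta_{A-1}^o:\lim_{N\to\infty}\mathbb{P}(sMon_i(\chi(0),N))=1\}$. Condition (M) for $i$: $\sum_{k\ge1}1/F_i(k)<\infty$. Type P: (M) and $\lim_kF_i(k)\sum_{l\ge k}1/F_i(l)=\infty$. Type E: (M) and $\limsup_kF_i(k)\sum_{l\ge k}1/F_i(l)<\infty$. *)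

(* Defs.v *)
From HB Require Import structures.
From mathcomp Require Import all_boot all_order all_algebra.
From mathcomp Require Import all_classical all_reals all_analysis.
Set Implicit Arguments. Unset Strict Implicit. Unset Printing Implicit Defensive.
Import Order.TTheory GRing.Theory Num.Theory.
Import numFieldNormedType.Exports.
Local Open Scope classical_set_scope.
Local Open Scope ring_scope.

Section Urn.
Variables (R : realType) (A : nat).

Definition pt := 'I_A -> R.
Definition config := {ffun 'I_A -> nat}.

(** Feedback functions: F i : R -> R is the C^1 extension of the feedback of agent i;
    the urn only uses the values F i k%:R at natural k. *)
Definition feedback := 'I_A -> R -> R.

Definition admissible_feedback (F : feedback) : Prop :=
  forall i : 'I_A,
    (forall x : R, 0 < x -> 0 < F i x) /\
    (forall x : R, 0 < x -> derivable (F i) x 1 /\ {for x, continuous (derive1 (F i))}) /\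
    (forall n : nat,
       (forall x y : R, 0 < x -> n%:R <= x -> x <= y -> y <= n.+1%:R -> F i x <= F i y) \/
       (forall x y : R, 0 < x -> n%:R <= x -> x <= y -> y <= n.+1%:R -> F i y <= F i x)).

Definition u_simplex (x : pt) : Prop := (forall j, 0 <= x j) /\ \sum_(j < A) x j = 1.
Definition u_simplex_int (x : pt) : Prop := (forall j, 0 < x j) /\ \sum_(j < A) x j = 1.

Definition u_total (F : feedback) (x : config) : R := \sum_(j < A) F j (x j)%:R.
Definition add_ball (x : config) (i : 'I_A) : config :=
  [ffun j => x j + (j == i)]%N.
Definition u_trans (F : feedback) (x y : config) : R :=
  \sum_(i < A) (if y == add_ball x i then F i (x i)%:R / u_total F x else 0).

Definition is_urn (F : feedback) (x0 : config) d (T : measurableType d)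
    (P : probability T R) (X : nat -> T -> config) : Prop :=
  (forall (n : nat) (x : config), measurable [set w | X n w = x]) /\
  (forall (n : nat) (path : nat -> config),
     P [set w | forall k, (k <= n)%N -> X k w = path k] =
     (if path 0%N == x0 then \prod_(k < n) u_trans F (path k) (path k.+1) else 0)%:E).

Definition sMon (i : 'I_A) T (X : nat -> T -> config) : set T :=
  [set w | exists M : nat, forall n : nat, (\sum_(j < A | j != i) X n w j <= M)%N].

(** Initial configuration X_i(0) = chi_i(0) N, rounded up (so X_i(0) >= 1 for N >= 1). *)
Definition u_init (chi : pt) (N : nat) : config :=
  [ffun j => `|Num.ceil (chi j * N%:R)|%N].

Definition attraction_domain (F : feedback) (i : 'I_A) : set pt :=
  [set chi | u_simplex_int chi /\
     forall eps : R, 0 < eps -> exists N0 : nat, forall N : nat, (N0 <= N)%N ->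
       forall d (T : measurableType d) (P : probability T R) (X : nat -> T -> config),
         is_urn F (u_init chi N) P X -> ((1 - eps)%:E < P (sMon i X))%E].

Definition cond_M (F : feedback) (i : 'I_A) : Prop :=
  cvgn (series (fun k : nat => (F i k.+1%:R)^-1)).

Definition u_tail (F : feedback) (i : 'I_A) (k : nat) : R :=
  limn (series (fun l : nat => (F i (k + l)%:R)^-1)).

Definition type_P (F : feedback) (i : 'I_A) : Prop :=
  cond_M F i /\ (fun k : nat => F i k%:R * u_tail F i k) @ \oo --> +oo.

Definition type_E (F : feedback) (i : 'I_A) : Prop :=
  cond_M F i /\ (limn_esup (fun k : nat => (F i k%:R * u_tail F i k)%:E) < +oo)%E.

Definition u_ratio (F : feedback) (chi : pt) (i j : 'I_A) (N : nat) : R :=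
  F i (chi i * N%:R) / F j (chi j * N%:R).

Definition u_close (x y : pt) (e : R) : Prop := forall j, `|y j - x j| < e.

Definition closure_in_simplex (D : set pt) : set pt :=
  [set x | u_simplex x /\ forall e : R, 0 < e -> exists2 y, D y & u_close x y e].

Definition interior_in_simplex (Q : set pt) : set pt :=
  [set x | Q x /\ exists2 e : R, 0 < e & forall y, u_simplex y -> u_close x y e -> Q y].

Definition u_polytope (m : nat) (a : 'I_m -> pt) (b : 'I_m -> R) : set pt :=
  [set x | u_simplex x /\ forall k : 'I_m, \sum_(j < A) a k j * x j <= b k].

Definition polytope_up_to_boundary (D : set pt) : Prop :=
  exists (m : nat) (a : 'I_m -> pt) (b : 'I_m -> R),
    (forall x, u_simplex_int x -> interior_in_simplex (u_polytope a b) x -> D x) /\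
    (forall x, D x -> u_polytope a b x).

End Urn.

(* Main.v *)
Require Import Defs.
From HB Require Import structures.
From mathcomp Require Import all_boot all_order all_algebra.
From mathcomp Require Import all_classical all_reals all_analysis.
From mathcomp Require Import ring lra zify.
Set Implicit Arguments. Unset Strict Implicit. Unset Printing Implicit Defensive.
Import Order.TTheory GRing.Theory Num.Theory.
Import numFieldNormedType.Exports.
Local Open Scope classical_set_scope.
Local Open Scope ring_scope.

(** In the exponential embedding agent i explodes at a time T_i with mean the tail sum
    S_i = sum_(k >= X_i(0)) 1 / F_i(k), and sMon_i is the event that T_i comes first.
    The embedding itself is avoided: with g and v close to the moment generating functions
    of T_i and -T_j, the process g(X_i) v(X_j) is a supermartingale of the urn, and Markov's
    inequality gives a Chernoff bound for the probability that X_j is unbounded. So j loses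
    against i when S_i / S_j tends to 0, and, for agents of type P, already when S_i / S_j
    stays below some rho < 1.

    Tail sums of type E decay geometrically, hence beat those of type P everywhere. For two
    competing agents and rays 0 < t < t', either j loses wherever chi_i >= t' chi_j or i loses
    wherever chi_i <= t chi_j. For type E one compares F_i and F_j along a single rational ray
    between t and t'. For type P, Baire's theorem makes the pointwise limits of
    F_i(chi_i N) / F_j(chi_j N) uniform on a small cone between the rays; summing over blocks
    of integer points of that cone compares S_i with S_j up to a factor that is compensated by
    the decay of the tail sums when the cone is left. Consequently every pair of agents has a
    critical ratio s_ij, the domains are cut out by chi_i > s_ij chi_j, and at a generic point
    the agent that does not lose beats all the others. *)

(** * Choice sequences and the law of the urn *)

Section ChoiceSequences.
Variables (R : realType) (A : nat) (F : feedback R A).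
Implicit Types (x y : config A) (i : 'I_A) (s : seq 'I_A) (phi : config A -> R).

Definition choice_prob x i : R := F i (x i)%:R / u_total F x.

Fixpoint seq_prob x s : R :=
  if s is i :: s' then choice_prob x i * seq_prob (add_ball x i) s' else 1.

Definition run x s (k : nat) : config A := foldl (@add_ball A) x (take k s).

(** The expectation of [phi] after n draws, computed by conditioning on the first draw, so that
    one-step inequalities iterate without a probability space. *)
Fixpoint urn_mean n phi x : R :=
  if n is m.+1 then \sum_(i < A) choice_prob x i * urn_mean m phi (add_ball x i)
  else phi x.

Definition positive x := forall j, (0 < x j)%N.

Definition feedback_pos := forall i (x : R), 0 < x -> 0 < F i x.

Hypothesis F0 : feedback_pos.
Hypothesis A0 : (0 < A)%N.

Lemma add_ball_inj x : injective (add_ball x).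
Proof.
move=> i j /ffunP /(_ i); rewrite !ffunE eqxx => /eqP.
by rewrite eqn_add2l; case: (i =P j).
Qed.

Lemma positive_add x i : positive x -> positive (add_ball x i).
Proof. by move=> x0 j; rewrite ffunE ltn_addr. Qed.

Lemma u_trans_add x i : u_trans F x (add_ball x i) = choice_prob x i.
Proof.
rewrite /u_trans (bigD1 i) //= eqxx big1 ?addr0 // => j ji.
by case: eqP => // /add_ball_inj ij; rewrite ij eqxx in ji.
Qed.

Lemma u_total_gt0 x : positive x -> 0 < u_total F x.
Proof.
move=> x0; rewrite /u_total (bigD1 (Ordinal A0)) //=.
rewrite ltr_pwDl ?F0 ?ltr0n // sumr_ge0 // => j _.
by rewrite ltW // F0 ?ltr0n.
Qed.

Lemma choice_prob_gt0 x i : positive x -> 0 < choice_prob x i.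
Proof. by move=> x0; rewrite divr_gt0 ?u_total_gt0 ?F0 ?ltr0n. Qed.

Lemma sum_choice_prob x : positive x -> \sum_(i < A) choice_prob x i = 1.
Proof. by move=> x0; rewrite -mulr_suml divff // gt_eqF // u_total_gt0. Qed.

Lemma seq_prob_ge0 x s : positive x -> 0 <= seq_prob x s.
Proof.
elim: s x => //= i s IH x x0.
by rewrite mulr_ge0 ?IH ?ltW ?choice_prob_gt0 //; apply: positive_add.
Qed.

Lemma run0 x s : run x s 0 = x.
Proof. by rewrite /run take0. Qed.

Lemma run_cons x i s k : run x (i :: s) k.+1 = run (add_ball x i) s k.
Proof. by []. Qed.

Lemma runS x s k : (k < size s)%N -> exists i, run x s k.+1 = add_ball (run x s k) i.
Proof.
elim: s x k => // j s IH x [|k] /= hk; first by exists j; rewrite /run /= take0.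
by rewrite !run_cons; apply: IH.
Qed.

Lemma seq_probE x s :
  seq_prob x s = \prod_(k < size s) u_trans F (run x s k) (run x s k.+1).
Proof.
elim: s x => [|i s IH] x /=; first by rewrite big_ord0.
rewrite big_ord_recl /= run_cons !run0 u_trans_add IH; congr (_ * _).
Qed.

Lemma run_inj x s t : size s = size t ->
  (forall k, (k <= size s)%N -> run x s k = run x t k) -> s = t.
Proof.
elim: s x t => [|i s IH] x [|j t] //= [st] e.
have ij : i = j.
  apply: (@add_ball_inj x).
  by have := e 1%N isT; rewrite !run_cons !run0.
subst j; congr (_ :: _); apply: (IH (add_ball x i)) => // k ks.
by have := e k.+1 ks; rewrite !run_cons.
Qed.

Lemma urn_meanE n phi x :
  urn_mean n phi x = \sum_(s : n.-tuple 'I_A) seq_prob x s * phi (run x s n).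
Proof.
elim: n x => [|n IH] x /=.
  rewrite (big_pred1 [tuple]) ?mul1r ?run0 //= => t.
  by rewrite [t]tuple0; exact/esym/eqP.
under eq_bigr do rewrite IH mulr_sumr.
rewrite (reindex (fun p : 'I_A * n.-tuple 'I_A => cons_tuple p.1 p.2)) /=; last first.
  exists (fun t => (thead t, behead_tuple t)) => [[i t] _ | t _] /=.
    by congr (_, _); apply/val_inj.
  by rewrite [RHS]tuple_eta; apply/val_inj.
rewrite pair_bigA /=; apply: eq_bigr => -[i t] _ /=.
by rewrite mulrA.
Qed.

Lemma urn_mean1 n x : positive x -> urn_mean n (fun=> 1) x = 1.
Proof.
elim: n x => //= n IH x x0.
rewrite -[RHS](sum_choice_prob x0); apply: eq_bigr => i _.
by rewrite IH ?mulr1 //; apply: positive_add.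
Qed.

(** The common factor 1 / [u_total] is positive, so the drift may be weighted by the feedback values
    themselves. Balls are only added, hence only configurations above [x] are ever reached. *)
Lemma supermartingale_urn_mean phi n x :
  (forall y, (forall j, (x j <= y j)%N) ->
    \sum_(i < A) F i (y i)%:R * (phi (add_ball y i) - phi y) <= 0) ->
  positive x -> urn_mean n phi x <= phi x.
Proof.
elim: n x => //= n IH x hx x0.
apply: (@le_trans _ _ (\sum_(i < A) choice_prob x i * phi (add_ball x i))).
  apply: ler_sum => i _; apply: ler_wpM2l; first exact/ltW/choice_prob_gt0.
  apply: IH; last exact: positive_add.
  move=> y xy; apply: hx => j; apply: leq_trans (xy j).
  by rewrite ffunE leq_addr.
rewrite -subr_le0.
have -> : phi x = \sum_(i < A) choice_prob x i * phi x.
  by rewrite -mulr_suml sum_choice_prob ?mul1r.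
rewrite -sumrB.
under eq_bigr => i _ do rewrite -mulrBr /choice_prob mulrAC.
rewrite -mulr_suml ler_pdivrMr ?u_total_gt0 // mul0r.
exact: hx.
Qed.

End ChoiceSequences.

Lemma fsum_fintype (R : realType) (I : finType) (D : set I) (f : I -> \bar R) :
  (\sum_(i \in D) f i = \sum_(i in D) f i)%E.
Proof.
rewrite (@bigfs _ _ _ _ (index_enum I) (mem D)) ?index_enum_uniq //.
  by congr (\sum_(i \in _) f i)%E; apply/seteqP; split => i /=; rewrite inE.
by move=> i _; rewrite mem_index_enum.
Qed.

Definition unbounded (A : nat) (j : 'I_A) T (X : nat -> T -> config A) : set T :=
  [set w | forall L, exists n, (L <= X n w j)%N].

(** * From cylinder probabilities to almost sure path properties *)

Section Law.
Variables (R : realType) (A : nat) (F : feedback R A).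
Hypotheses (F0 : feedback_pos F) (A0 : (0 < A)%N).
Variables (x0 : config A) (d : measure_display) (T : measurableType d).
Variables (P : probability T R) (X : nat -> T -> config A).
Hypotheses (x0_pos : positive x0) (hX : is_urn F x0 P X).

Lemma le_measure_mod_null (B C N : set T) : measurable B -> measurable C ->
  measurable N -> P N = 0%E -> B `<=` C `|` N -> (P B <= P C)%E.
Proof.
move=> mB mC mN N0 BCN; rewrite -(measureU0 mC mN N0).
by apply: le_measure; rewrite ?inE //; apply: measurableU.
Qed.

(** [is_urn] provides measurability for single configurations; there are countably many of them, and
    [unpickle] enumerates them. *)
Lemma measurable_config n (B : set (config A)) : measurable [set w | B (X n w)].
Proof.
have -> : [set w | B (X n w)] = \bigcup_k
    (if unpickle k is Some x then [set w | B x /\ X n w = x] else set0).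
  apply/seteqP; split => w /=.
    by move=> Bw; exists (pickle (X n w)) => //; rewrite pickleK.
  by case=> k _; case: (unpickle k) => //= x [Bx ->].
apply: bigcupT_measurable => k; case: (unpickle k) => // x.
have [Bx|nBx] := pselect (B x).
  have -> : [set w | B x /\ X n w = x] = [set w | X n w = x].
    by apply/seteqP; split => w //= -[].
  exact: hX.1.
have -> : [set w | B x /\ X n w = x] = set0; last exact: measurable0.
by apply/seteqP; split => w //= -[].
Qed.

Definition cylinder (s : seq 'I_A) : set T :=
  [set w | forall k, (k <= size s)%N -> X k w = run x0 s k].

Lemma measurable_cylinder s : measurable (cylinder s).
Proof.
have -> : cylinder s =
    \bigcap_k (if (k <= size s)%N then [set w | X k w = run x0 s k] else setT).
  apply/seteqP; split => w /= h k; first by move=> _; case: ifP => // ks; apply: h.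
  by move=> ks; have := h k I; rewrite ks.
by apply: bigcapT_measurable => k; case: ifP => // _; apply: hX.1.
Qed.

Lemma prob_cylinder s : P (cylinder s) = (seq_prob F x0 s)%:E.
Proof. by rewrite [LHS]hX.2 run0 eqxx seq_probE. Qed.

Lemma trivIset_cylinder n (D : set (n.-tuple 'I_A)) : trivIset D cylinder.
Proof.
move=> s t _ _ [w [sw tw]]; apply/val_inj/(@run_inj _ x0) => /=; rewrite ?size_tuple //.
by move=> k kn; rewrite -sw ?size_tuple // tw ?size_tuple.
Qed.

(** [is_urn] prescribes a law, so an individual path may jump arbitrarily. On this event, of
    probability 1, the path starts at [x0] and each of the first n steps adds one ball. *)
Definition guided n : set T := \bigcup_(s in [set: n.-tuple 'I_A]) cylinder s.

Lemma prob_bigcup_cylinder n (D : set (n.-tuple 'I_A)) :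
  P (\bigcup_(s in D) cylinder s) = (\sum_(s in D) seq_prob F x0 s)%:E.
Proof.
rewrite measure_fin_bigcup; last 3 first.
- exact: finite_finset.
- exact: trivIset_cylinder.
- by move=> s _; exact: measurable_cylinder.
rewrite fsum_fintype -sumEFin; apply: eq_bigr => s _; exact: prob_cylinder.
Qed.

Lemma measurable_bigcup_cylinder n (D : set (n.-tuple 'I_A)) :
  measurable (\bigcup_(s in D) cylinder s).
Proof. by apply: fin_bigcup_measurable => [|s _]; [exact: finite_finset|exact: measurable_cylinder]. Qed.

Lemma prob_guided n : P (guided n) = 1%E.
Proof.
rewrite prob_bigcup_cylinder; congr (_%:E).
rewrite -(urn_mean1 F0 A0 n x0_pos) urn_meanE.
by apply: eq_big => [s|s _]; rewrite ?in_setT ?mulr1.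
Qed.

(** Markov's inequality: off a null set the first n steps form a choice sequence, and the
    expectation of [phi] is a sum over these sequences. *)
Lemma prob_config_le n (B : set (config A)) phi :
  (forall y, 0 <= phi y) -> (forall y, B y -> 1 <= phi y) ->
  (P [set w | B (X n w)] <= (urn_mean F n phi x0)%:E)%E.
Proof.
move=> phi0 phi1; pose D := [set s : n.-tuple 'I_A | B (run x0 s n)].
apply: (@le_trans _ _ (P (\bigcup_(s in D) cylinder s))).
  apply: (@le_measure_mod_null _ _ (~` guided n)).
  - exact: measurable_config.
  - exact: measurable_bigcup_cylinder.
  - exact/measurableC/measurable_bigcup_cylinder.
  - by rewrite probability_setC ?prob_guided ?subee //; exact: measurable_bigcup_cylinder.
  - move=> w /= Bw; have [[s _ sw]|] := pselect (guided n w); last by right.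
    by left; exists s => //; rewrite /D /= -sw ?size_tuple.
rewrite prob_bigcup_cylinder lee_fin urn_meanE [leRHS](bigID (mem D)) /=.
rewrite ler_wpDr ?sumr_ge0 // => [s _|].
  by rewrite mulr_ge0 ?seq_prob_ge0.
apply: ler_sum => s; rewrite inE /D /= => Bs.
by rewrite ler_peMr ?seq_prob_ge0 ?phi1.
Qed.

Definition regular_path : set T := \bigcap_n guided n.

Lemma measurable_regular_path : measurable regular_path.
Proof. by apply: bigcapT_measurable => n; exact: measurable_bigcup_cylinder. Qed.

Lemma prob_not_regular_path : P (~` regular_path) = 0%E.
Proof.
rewrite setC_bigcap; apply/eqP; rewrite -measure_le0.
have mG n : measurable (~` guided n) by apply/measurableC/measurable_bigcup_cylinder.
have mUG : measurable (\bigcup_n ~` guided n) by apply: bigcupT_measurable.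
apply: (le_trans (measure_sigma_subadditive P mG mUG (@subset_refl _ _))).
rewrite eseries0 // => n _ _ /=.
by rewrite probability_setC ?prob_guided ?subee //; exact: measurable_bigcup_cylinder.
Qed.

Lemma regular_pathS w n : regular_path w -> exists i, X n.+1 w = add_ball (X n w) i.
Proof.
move=> /(_ n.+1 I) [s _ sw]; have ns : (n < size s)%N by rewrite size_tuple.
have [i ri] := runS x0 ns; exists i.
by rewrite !sw // ltnW.
Qed.

Lemma regular_path_mono w j m n : regular_path w -> (m <= n)%N ->
  (X m w j <= X n w j)%N.
Proof.
move=> rw /subnK <-; elim: (n - m)%N => // k IH.
have [i ->] := regular_pathS (k + m) rw.
by rewrite ffunE; apply: leq_trans IH (leq_addr _ _).
Qed.

Lemma regular_path_total w n : regular_path w -> (n <= \sum_(j < A) X n w j)%N.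
Proof.
move=> rw; elim: n => // n IH; have [i ->] := regular_pathS n rw.
under eq_bigr do rewrite ffunE.
by rewrite big_split /= -[n.+1]addn1 leq_add // (bigD1 i) //= eqxx leq_addr.
Qed.

Lemma measurable_unbounded j : measurable (unbounded j X).
Proof.
have -> : unbounded j X = \bigcap_L \bigcup_n [set w | (L <= X n w j)%N].
  apply/seteqP; split => w h L; first by have [n] := h L; exists n.
  by have [n _] := h L I; exists n.
apply: bigcapT_measurable => L; apply: bigcupT_measurable => n.
exact: (measurable_config n [set x : config A | (L <= x j)%N]).
Qed.

(** On regular paths the count of j is nondecreasing, so the events [L <= X n w j] increase with n,
    and continuity from below carries the uniform bound to their union. *)
Lemma prob_unbounded_le j L (c : R) :
  (forall n, (P [set w | (L <= X n w j)%N] <= c%:E)%E) ->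
  (P (unbounded j X) <= c%:E)%E.
Proof.
move=> Pc; pose V n := [set w | (L <= X n w j)%N] `&` regular_path.
have mL n : measurable [set w | (L <= X n w j)%N].
  exact: (measurable_config n [set x : config A | (L <= x j)%N]).
have mV n : measurable (V n) by apply: measurableI => //; exact: measurable_regular_path.
have mUV : measurable (\bigcup_n V n) by apply: bigcupT_measurable.
have hV : {homo V : n m / (n <= m)%N >-> (n <= m)%O}.
  move=> m n mn; apply/subsetPset => w [Lw rw]; split => //=.
  exact: leq_trans Lw (regular_path_mono j rw mn).
apply: (@le_trans _ _ (P (\bigcup_n V n))).
  apply: (@le_measure_mod_null _ _ (~` regular_path)) => //.
  - exact: measurable_unbounded.
  - exact/measurableC/measurable_regular_path.
  - exact: prob_not_regular_path.
  - move=> w /= /(_ L) [n Ln]; have [rw|] := pselect (regular_path w); last by right.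
    by left; exists n.
have cV : (P \o V) x @[x --> \oo] --> P (\bigcup_n V n) := nondecreasing_cvg_mu mV mUV hV.
rewrite -(cvg_lim _ cV) //; apply: lime_le; first by apply/cvg_ex; exists (P (\bigcup_n V n)).
apply: nearW => n; apply: le_trans (Pc n).
by apply: le_measure; rewrite ?inE // => w [].
Qed.

End Law.

(** * Existence of the urn *)

Section UrnExistence.
Variables (R : realType) (A : nat) (F : feedback R A).
Hypotheses (F0 : feedback_pos F) (A0 : (0 < A)%N).
Implicit Types (x y : config A) (i : 'I_A) (w : R).

Definition cumulative x (k : nat) : R := \sum_(j < A | (j < k)%N) choice_prob F x j.

(** For w in the unit interval and positive [x] exactly one agent is picked; the default only makes
    the function total. *)
Definition digit x w : 'I_A :=
  odflt (Ordinal A0) [pick i : 'I_A | cumulative x i <= w < cumulative x i.+1].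

Definition rescale x w : R :=
  (w - cumulative x (digit x w)) / choice_prob F x (digit x w).

(* The initial configuration and the base-[choice_prob] digits of w determine the
   path: the unit interval is split among the agents according to the transition
   probabilities, and the part containing w is rescaled to the unit interval. *)
Fixpoint path_of x n w : config A :=
  if n is m.+1 then path_of (add_ball x (digit x w)) m (rescale x w) else x.

Lemma cumulativeS x i : cumulative x i.+1 = cumulative x i + choice_prob F x i.
Proof.
rewrite /cumulative (bigD1 i) //= addrC; congr (_ + _).
by apply: eq_bigl => j; rewrite ltnS ltn_neqAle andbC.
Qed.

Lemma cumulative_mono x : positive x -> {homo cumulative x : k l / (k <= l)%N >-> k <= l}.
Proof.
move=> x0 k l kl; rewrite /cumulative [leRHS](bigID (fun j : 'I_A => (j < k)%N)) /=.
have -> : \sum_(j < A | (j < l)%N && (j < k)%N) choice_prob F x j =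
          \sum_(j < A | (j < k)%N) choice_prob F x j.
  apply: eq_bigl => j; apply/andb_idl => jk; exact: leq_trans jk kl.
by rewrite lerDl sumr_ge0 // => j _; exact/ltW/choice_prob_gt0.
Qed.

Lemma cumulative_max x : positive x -> cumulative x A = 1.
Proof.
move=> x0; rewrite -[RHS](sum_choice_prob F0 A0 x0).
by apply: eq_bigl => j; rewrite ltn_ord.
Qed.

Lemma digitP x w i : positive x -> cumulative x i <= w < cumulative x i.+1 ->
  digit x w = i.
Proof.
move=> x0 /andP[iw wi]; rewrite /digit; case: pickP => [j /andP[jw wj]|/(_ i)] /=.
  apply/val_inj; case: (ltngtP i j) => // ij.
    by have := lt_le_trans wi (le_trans (cumulative_mono x0 ij) jw); rewrite ltxx.
  by have := lt_le_trans wj (le_trans (cumulative_mono x0 ij) iw); rewrite ltxx.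
by rewrite iw wi.
Qed.

Lemma digit_bounds x w : positive x -> 0 <= w < 1 ->
  cumulative x (digit x w) <= w < cumulative x (digit x w).+1.
Proof.
move=> x0 /andP[w0 w1].
have ex : exists k, w < cumulative x k by exists A; rewrite cumulative_max.
case: (ex_minnP ex) => -[|k] wk mink.
  by move: wk; rewrite /cumulative big_pred0 // ltNge w0.
have kA : (k < A)%N by apply: mink; rewrite cumulative_max.
rewrite (@digitP x w (Ordinal kA)) //= wk andbT leNgt.
all: by rewrite ?wk ?andbT ?leNgt; apply/negP => /mink; rewrite ltnn.
Qed.

Lemma rescale_bounds x w : positive x -> 0 <= w < 1 -> 0 <= rescale x w < 1.
Proof.
move=> x0 w01; have /andP[] := digit_bounds x0 w01; rewrite cumulativeS => a b.
apply/andP; split; first by apply: divr_ge0; rewrite ?subr_ge0 //; exact/ltW/choice_prob_gt0.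
by rewrite ltr_pdivrMr ?choice_prob_gt0 // mul1r ltrBlDl.
Qed.

Lemma path_of_run x n w : exists2 s : seq 'I_A, size s = n &
  forall k, (k <= n)%N -> path_of x k w = run x s k.
Proof.
elim: n x w => [|n IH] x w.
  by exists [::] => // -[|k] // _; rewrite run0.
have [s ss hs] := IH (add_ball x (digit x w)) (rescale x w).
exists (digit x w :: s) => [|[|k] kn]; rewrite /= ?ss // ?run0 // run_cons.
exact: hs.
Qed.

Definition follows x (path : nat -> config A) n : set R :=
  [set w | 0 <= w < 1 /\ forall k, (k <= n)%N -> path_of x k w = path k].

Definition path_prob x (path : nat -> config A) n : R :=
  if path 0%N == x then \prod_(k < n) u_trans F (path k) (path k.+1) else 0.

Lemma follows_empty x path n : follows x path n `<=` set0 ->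
  exists a, follows x path n = `[a, a + 0[%classic.
Proof.
by move=> e; exists 0; rewrite addr0 set_itvco0 ?lexx //; apply/seteqP.
Qed.

(** A point follows the path exactly when its digit is the first chosen agent and its rescaling
    follows the shifted path. Pulling an interval back along this affine rescaling multiplies its
    length by [choice_prob]. *)
Lemma follows_itv_step x (path : nat -> config A) n : positive x -> path 0%N = x ->
  (forall y path', positive y -> 0 <= path_prob y path' n /\
    exists a, follows y path' n = `[a, a + path_prob y path' n[%classic) ->
  0 <= \prod_(k < n.+1) u_trans F (path k) (path k.+1) /\
  exists a, follows x path n.+1 =
    `[a, a + \prod_(k < n.+1) u_trans F (path k) (path k.+1)[%classic.
Proof.
move=> x0 p0 IH; rewrite big_ord_recl p0 /=.
(* If no single ball leads from [x] to [path 1], the transition probability is 0 and no point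
   follows the path. *)
have [[i p1]|np] := pselect (exists i, path 1%N = add_ball x i); last first.
  have -> : u_trans F x (path 1%N) = 0.
    by apply: big1 => i _; case: eqP => // p1; case: np; exists i.
  rewrite mul0r; split=> //; apply: follows_empty => w [_ /(_ 1%N isT)] /= e.
  by case: np; exists (digit x w).
have p_gt0 := @choice_prob_gt0 _ _ _ F0 A0 x i x0.
have [l0 [a fa]] := IH (add_ball x i) (path \o S) (positive_add i x0).
set l := path_prob _ _ _ in l0 fa.
have el : \prod_(k < n) u_trans F (path (bump 0 k)) (path (bump 0 k).+1) = l.
  by rewrite /l /path_prob /= p1 eqxx.
rewrite p1 u_trans_add el; split; first by rewrite mulr_ge0 // ltW.
exists (cumulative x i + choice_prob F x i * a).
have key w : (0 <= w < 1 /\ digit x w = i) <-> cumulative x i <= w < cumulative x i.+1.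
  split=> [[w01 <-]|h]; first exact: digit_bounds.
  split; last exact: digitP.
  case/andP: h => h1 h2; apply/andP; split.
    by apply: le_trans h1; apply: sumr_ge0 => j _; exact/ltW/choice_prob_gt0.
  by apply: (lt_le_trans h2); rewrite -(cumulative_max x0) cumulative_mono.
have mem w : (w \in `[cumulative x i + choice_prob F x i * a,
   cumulative x i + choice_prob F x i * a + choice_prob F x i * l[) =
   ((w - cumulative x i) / choice_prob F x i \in `[a, a + l[).
  rewrite !in_itv /= ler_pdivlMr // ltr_pdivrMr // lerBrDl ltrBlDl.
  by rewrite (mulrC a) mulrDl addrA (mulrC a) (mulrC l).
apply/seteqP; split => w /=; rewrite mem.
  case=> w01 h.
  have di : digit x w = i.
    by apply: (@add_ball_inj _ x); rewrite -p1 -(h 1%N isT).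
  suff : follows (add_ball x i) (path \o S) n (rescale x w).
    by rewrite fa /= /rescale di.
  split; first exact: rescale_bounds.
  by move=> k kn; rewrite /= -(h k.+1 kn) /= di.
move=> h; have : follows (add_ball x i) (path \o S) n
    ((w - cumulative x i) / choice_prob F x i) by rewrite fa.
case=> /andP[r0 r1] hk.
have /key [w01 di] : cumulative x i <= w < cumulative x i.+1.
  move: r0 r1; rewrite ler_pdivlMr // mul0r subr_ge0 => ->.
  by rewrite ltr_pdivrMr // mul1r ltrBlDl cumulativeS.
split=> // -[|k] kn //=.
by rewrite /rescale di hk.
Qed.

Lemma follows_itv x path n : positive x ->
  0 <= path_prob x path n /\
  exists a, follows x path n = `[a, a + path_prob x path n[%classic.
Proof.
elim: n x path => [|n IH] x path x0; rewrite /path_prob; case: eqP => p0.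
- rewrite big_ord0; split=> //; exists 0; rewrite add0r; apply/seteqP; split => w /=.
    by case=> w01 _; rewrite in_itv.
  by rewrite in_itv => w01; split=> // -[].
- by split=> //; apply: follows_empty => w [_ /(_ 0%N isT)] /= e; case: p0.
- exact: follows_itv_step.
- by split=> //; apply: follows_empty => w [_ /(_ 0%N isT)] /= e; case: p0.
Qed.

Local Notation unif := (uniform_prob (ltr01 : 0 < 1 :> R)).

Lemma uniform_prob_itv (a l : R) : 0 <= l ->
  (`[a, a + l[%classic `<=` [set w : R | 0 <= w < 1]) ->
  unif `[a, a + l[%classic = l%:E.
Proof.
rewrite le_eqVlt => /predU1P[<- _|l0 sub].
  by rewrite addr0 set_itvco0 ?lexx // measure0.
have al1 : a + l <= 1.
  (* If the interval went beyond 1, it would contain [Num.max a 1], which is not below 1. *)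
  rewrite leNgt; apply/negP => al; pose c := Num.max a 1.
  have /sub /= : `[a, a + l[%classic c.
    rewrite /= in_itv /= /c le_max lexx /= gt_max al andbT.
    by rewrite ltrDl.
  by rewrite /c gt_max ltxx !andbF.
have a0 : 0 <= a.
  have /sub /= : `[a, a + l[%classic a by rewrite /= in_itv /= lexx ltrDl.
  by case/andP.
rewrite /uniform_prob (eq_integral (cst 1%E)); last first.
  move=> w; rewrite inE /= in_itv /= /uniform_pdf => /andP[aw wl].
  by rewrite (le_trans a0 aw) (le_trans (ltW wl) al1) /= subr0 invr1.
rewrite integral_cst //= mul1e lebesgue_measure_itv /= lte_fin ltrDl l0.
by rewrite -EFinD addrAC subrr add0r.
Qed.

Lemma uniform_prob_outside : unif (~` [set w | 0 <= w < 1]) = 0%E.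
Proof.
have e : [set w : R | 0 <= w < 1] = `[0, 0 + 1[%classic.
  by apply/seteqP; split => w /=; rewrite in_itv /= add0r.
have m : measurable [set w : R | 0 <= w < 1] by rewrite e; exact: measurable_itv.
have e1 : unif [set w | 0 <= w < 1] = 1%E.
  by rewrite {1}e uniform_prob_itv ?ler01 // -e.
by rewrite probability_setC // [X in (1 - X)%E]e1 subee.
Qed.

(** Freezing the process outside the unit interval, a null set for the uniform law, reduces
    measurability to that of the intervals in [follows_itv]. *)
Definition urn_process x n w : config A := if 0 <= w < 1 then path_of x n w else x.

Lemma urn_process_is_urn x : positive x -> is_urn F x unif (urn_process x).
Proof.
move=> x0.
have m01 : measurable [set w : R | 0 <= w < 1].
  have -> : [set w : R | 0 <= w < 1] = `[0, 1[%classic.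
    by apply/seteqP; split => w /=; rewrite in_itv.
  exact: measurable_itv.
have mf path n : measurable (follows x path n).
  by have [_ [a ->]] := follows_itv path n x0; exact: measurable_itv.
have mX n y : measurable [set w | urn_process x n w = y].
  have -> : [set w | urn_process x n w = y] =
      (\bigcup_(s in [set s : n.-tuple 'I_A | run x s n = y]) follows x (run x s) n)
      `|` (~` [set w | 0 <= w < 1] `&` (if x == y then setT else set0)).
    apply/seteqP; split => w /=; rewrite /urn_process.
      case: ifPn => [w01 e|w01 ->]; last by right; rewrite eqxx.
      left; have [s ss hs] := path_of_run x n w.
      have sP : size s == n by exact/eqP.
      by exists (Tuple sP) => /=; [rewrite -hs | split].
    case=> [[s /= <- [w01 hs]]|[/negP/negbTE -> ]]; first by rewrite w01 hs.
    by case: eqP.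
  apply: measurableU.
    by apply: fin_bigcup_measurable => [|s _]; [exact: finite_finset|exact: mf].
  by apply: measurableI; [exact: measurableC|case: ifP].
split=> // n path; rewrite -/(path_prob x path n).
have [l0 [a fa]] := follows_itv path n x0.
rewrite -(uniform_prob_itv l0 (a := a)) -?fa; last by move=> w [].
have mS : measurable [set w | forall k, (k <= n)%N -> urn_process x k w = path k].
  have -> : [set w | forall k, (k <= n)%N -> urn_process x k w = path k] =
     \bigcap_k (if (k <= n)%N then [set w | urn_process x k w = path k] else setT).
    apply/seteqP; split => w /= h k; first by move=> _; case: ifP => // kn; apply: h.
    by move=> kn; have := h k I; rewrite kn.
  by apply: bigcapT_measurable => k; case: ifP.
apply/eqP; rewrite eq_le; apply/andP; split.
  apply: (@le_measure_mod_null R _ _ unif _ _ _ mS (mf _ _) (measurableC m01) uniform_prob_outside).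
  move=> w /= h; have [w01|w01] := boolP (0 <= w < 1); last by right; exact/negP.
  by left; split=> // k kn; rewrite -h // /urn_process w01.
apply: le_measure; rewrite ?inE; [exact: mf|exact: mS|].
by move=> w [w01 h] k kn; rewrite /urn_process w01 h.
Qed.

End UrnExistence.

(** * Attraction domains and losing agents *)

Lemma eventually_forall (I : finType) (Q : I -> nat -> Prop) :
  (forall i, exists n0, forall n, (n0 <= n)%N -> Q i n) ->
  exists n0, forall n, (n0 <= n)%N -> forall i, Q i n.
Proof.
move=> /choice[f hf]; exists (\max_i f i)%N => n hn i; apply: hf.
exact: leq_trans (leq_bigmax i) hn.
Qed.

Section AttractionDomains.
Variables (R : realType) (A : nat) (F : feedback R A).
Hypotheses (F0 : feedback_pos F) (A0 : (0 < A)%N).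
Implicit Types (i j : 'I_A) (chi : pt R A).

(** With probability tending to 1, agent j receives finitely many balls. As in [attraction_domain],
    the bound is required of every realisation of the urn. *)
Definition loses j chi := forall eps : R, 0 < eps -> exists N0, forall N, (N0 <= N)%N ->
  forall d (T : measurableType d) (P : probability T R) (X : nat -> T -> config A),
    is_urn F (u_init chi N) P X -> (P (unbounded j X) <= eps%:E)%E.

Lemma u_init_pos chi N : u_simplex_int chi -> (0 < N)%N -> positive (u_init chi N).
Proof.
move=> [chi0 _] N0 j; rewrite ffunE absz_gt0 gt_eqF // ceil_gt0.
by rewrite mulr_gt0 ?ltr0n.
Qed.

(** [attraction_domain] and [loses] quantify over realisations; an actual realisation is what makes
    two such statements contradict each other. *)
Lemma urn_exists chi N : u_simplex_int chi -> (0 < N)%N ->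
  exists d (T : measurableType d) (P : probability T R) (X : nat -> T -> config A),
    is_urn F (u_init chi N) P X.
Proof.
move=> hchi N0; do 4 eexists; exact: (urn_process_is_urn F0 A0 (u_init_pos hchi N0)).
Qed.

Section Urn.
Variables (x0 : config A) (d : measure_display) (T : measurableType d).
Variables (P : probability T R) (X : nat -> T -> config A).
Hypotheses (x0_pos : positive x0) (hX : is_urn F x0 P X).

Lemma measurable_sMon i : measurable (sMon i X).
Proof.
have -> : sMon i X =
    \bigcup_M \bigcap_n [set w | (\sum_(j < A | j != i) X n w j <= M)%N].
  apply/seteqP; split => w; first by case=> M h; exists M => // n _; apply: h.
  by case=> M _ h; exists M => n; exact: (h n).
apply: bigcupT_measurable => M; apply: bigcapT_measurable => n.
exact: (measurable_config hX n [set x : config A | (\sum_(j < A | j != i) x j <= M)%N]).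
Qed.

Lemma prob_bigcup_unbounded_le (D : set 'I_A) (c : R) : 0 <= c ->
  (forall j, D j -> (P (unbounded j X) <= c%:E)%E) ->
  (P (\bigcup_(j in D) unbounded j X) <= (c *+ A)%:E)%E.
Proof.
move=> c0 Pc.
(* The agents of [D] are placed among the naturals below A, with empty sets elsewhere, to fit
   Boole's inequality for sequences. *)
pose G (k : nat) : set T := if insub k is Some j then
  if pselect (D j) then unbounded j X else set0 else set0.
have mG k : measurable (G k).
  rewrite /G; case: insub => // j; case: pselect => //= ?; exact: (measurable_unbounded hX).
have -> : \bigcup_(j in D) unbounded j X = \big[setU/set0]_(k < A) G k.
  rewrite -bigcup_mkord; apply/seteqP; split => w.
    case=> j Dj h; exists j; first exact: ltn_ord.
    by rewrite /G valK; case: pselect.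
  case=> k /= kA; rewrite /G insubT; case: pselect => // Dj h.
  by exists (Sub k kA).
apply: le_trans (Boole_inequality P (fun k _ => mG k)) _.
rewrite -[X in (c *+ X)](card_ord A) -sumr_const -sumEFin.
apply: lee_sum => k _; rewrite /G; case: insubP => [j _ _|_]; last by rewrite measure0.
by case: pselect => [Dj|Dj] /=; [exact: Pc|rewrite measure0].
Qed.

Lemma setC_sMon i : ~` sMon i X `<=` \bigcup_(j in [set j | j != i]) unbounded j X.
Proof.
move=> w nM; apply: contrapT => nU; apply: nM.
have /choice[f hf] : forall j, exists L, forall n, j != i -> (X n w j <= L)%N.
  move=> j; have [->|ji] := eqVneq j i; first by exists 0%N.
  apply: contrapT => nL; apply: nU; exists j => // L.
  apply: contrapT => nn; apply: nL; exists L => n _; rewrite leqNgt; apply/negP => Ln.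
  by apply: nn; exists n; exact: ltnW.
exists (\sum_(j < A | j != i) f j)%N => n.
by apply: leq_sum => j ji; exact: hf.
Qed.

(** After n steps there are at least n balls, while the other agents together hold at most M. *)
Lemma sMon_unbounded i w : regular_path x0 X w -> sMon i X w -> unbounded i X w.
Proof.
move=> rw [M hM] L; exists (L + M)%N.
have := regular_path_total (L + M) rw; rewrite (bigD1 i) //=.
move=> h; rewrite -(leq_add2r M); apply: leq_trans h _.
by rewrite leq_add2l.
Qed.

Lemma sMon_bounded i j w : i != j -> sMon i X w -> ~ unbounded j X w.
Proof.
move=> ij [M hM] /(_ M.+1) [n]; have := hM n; rewrite (bigD1 j) 1?eq_sym //= => h1 h2.
by have := leq_trans h2 (leq_trans (leq_addr _ _) h1); rewrite ltnn.
Qed.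

Lemma regular_unbounded w : regular_path x0 X w ->
  (\bigcup_(j in [set: 'I_A]) unbounded j X) w.
Proof.
move=> rw; have [s|s] := pselect (sMon (Ordinal A0) X w).
  by exists (Ordinal A0) => //; exact: sMon_unbounded.
by have [j _ uj] := setC_sMon s; exists j.
Qed.

Lemma measurable_bigcup_unbounded (D : set 'I_A) :
  measurable (\bigcup_(j in D) unbounded j X).
Proof.
by apply: fin_bigcup_measurable => [|j _]; [exact: finite_finset|exact: (measurable_unbounded hX)].
Qed.

(** Outside [sMon i X] some other agent is unbounded. The union bound over at most A agents costs
    eps / 2; the other half gives the strict inequality. *)
Lemma prob_sMon_lt (eps : R) i : 0 < eps ->
  (forall j, j != i -> (P (unbounded j X) <= (eps / (2 * A%:R))%:E)%E) ->
  ((1 - eps)%:E < P (sMon i X))%E.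
Proof.
move=> eps0 hj; have mS := measurable_sMon i.
have A0' : 0 < A%:R :> R by rewrite ltr0n.
have : (P (~` sMon i X) <= (eps / 2)%:E)%E.
  apply: (@le_trans _ _ (P (\bigcup_(j in [set j | j != i]) unbounded j X))).
    apply: le_measure; rewrite ?inE; [exact: measurableC| |exact: setC_sMon].
    exact: measurable_bigcup_unbounded.
  apply: (le_trans (@prob_bigcup_unbounded_le _ (eps / (2 * A%:R)) _ _)) => //.
    by rewrite divr_ge0 ?mulr_ge0 ?ltW.
  rewrite lee_fin -mulr_natr le_eqVlt; apply/orP; left; apply/eqP; field.
  by rewrite gt_eqF.
rewrite probability_setC // -(fineK (fin_num_measure P _ mS)) -EFinD !lte_fin !lee_fin.
lra.
Qed.

Lemma prob_sMon_le_unbounded i : (P (sMon i X) <= P (unbounded i X))%E.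
Proof.
apply: (@le_measure_mod_null _ _ _ _ _ _ (~` regular_path x0 X)).
- exact: measurable_sMon.
- exact: (measurable_unbounded hX).
- exact/measurableC/(measurable_regular_path hX).
- exact: (prob_not_regular_path F0 A0 x0_pos hX).
- move=> w s; have [rw|] := pselect (regular_path x0 X w); last by right.
  by left; exact: sMon_unbounded.
Qed.

(** Almost surely some agent is unbounded, whereas the union bound would leave total mass at most 1
    / 2. *)
Lemma unbounded_not_all_unlikely :
  ~ (forall j, (P (unbounded j X) <= (1 / (2 * A%:R))%:E)%E).
Proof.
move=> hj; have A0' : 0 < A%:R :> R by rewrite ltr0n.
have : (P [set: T] <= (1 / 2)%:E)%E.
  apply: (@le_trans _ _ (P (\bigcup_(j in [set: 'I_A]) unbounded j X))).
    apply: (@le_measure_mod_null _ _ _ _ _ _ (~` regular_path x0 X)) => //.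
    - exact: measurable_bigcup_unbounded.
    - exact/measurableC/(measurable_regular_path hX).
    - exact: (prob_not_regular_path F0 A0 x0_pos hX).
    - move=> w _; have [rw|] := pselect (regular_path x0 X w); last by right.
      by left; exact: regular_unbounded.
  have c0 : 0 <= 1 / (2 * A%:R) :> R by rewrite divr_ge0 ?mulr_ge0 ?ltW.
  apply: (le_trans (prob_bigcup_unbounded_le c0 (fun j _ => hj j))).
  rewrite lee_fin -mulr_natr le_eqVlt; apply/orP; left; apply/eqP; field.
  by rewrite gt_eqF.
rewrite probability_setT lee_fin; lra.
Qed.

Lemma prob_sMon_sum i j : i != j -> (P (sMon i X) + P (sMon j X) <= 1)%E.
Proof.
move=> ij; have mi := measurable_sMon i; have mj := measurable_sMon j.
have : (P (sMon j X) <= P (~` sMon i X))%E.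
  apply: (@le_measure_mod_null _ _ _ _ _ _ (~` regular_path x0 X)) => //.
  - exact: measurableC.
  - exact/measurableC/(measurable_regular_path hX).
  - exact: (prob_not_regular_path F0 A0 x0_pos hX).
  - move=> w s; have [rw|] := pselect (regular_path x0 X w); last by right.
    left => /(sMon_bounded ij); apply; exact: sMon_unbounded.
rewrite probability_setC // -(fineK (fin_num_measure P _ mi)).
rewrite -(fineK (fin_num_measure P _ mj)) -EFinD -EFinD !lee_fin.
lra.
Qed.

End Urn.

Lemma attraction_domain_if chi i : u_simplex_int chi ->
  (forall j, j != i -> loses j chi) -> attraction_domain F i chi.
Proof.
move=> hchi hj; split=> // eps eps0.
have eA : 0 < eps / (2 * A%:R) by rewrite divr_gt0 ?mulr_gt0 ?ltr0n.
have [N0 hN0] : exists N0, forall N, (N0 <= N)%N -> forall j, j != i ->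
    forall d (T : measurableType d) (P : probability T R) (X : nat -> T -> config A),
    is_urn F (u_init chi N) P X -> (P (unbounded j X) <= (eps / (2 * A%:R))%:E)%E.
  apply: eventually_forall => j; have [->|ji] := eqVneq j i; first by exists 0%N.
  by have [N0 h] := hj j ji _ eA; exists N0 => N NN0 _; exact: h.
exists N0 => N NN0 d T P X hX.
by apply: (prob_sMon_lt hX) => // j ji; exact: (hN0 N).
Qed.

Lemma loses_attraction_domain chi i : loses i chi -> ~ attraction_domain F i chi.
Proof.
move=> li [hchi hi]; have [N1 h1] := li (1 / 2) ltac:(lra).
have [N2 h2] := hi (1 / 2) ltac:(lra).
pose N := (N1 + N2).+1; have N0 : (0 < N)%N by [].
have [d [T [P [X hX]]]] := urn_exists hchi N0.
have := h1 N ltac:(rewrite /N; lia) _ _ _ _ hX.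
have := h2 N ltac:(rewrite /N; lia) _ _ _ _ hX.
move=> a b; have := lt_le_trans a (le_trans (prob_sMon_le_unbounded (u_init_pos hchi N0) hX i) b).
by rewrite lte_fin; lra.
Qed.

Lemma exists_not_loses chi : u_simplex_int chi -> exists i, ~ loses i chi.
Proof.
move=> hchi; apply: contrapT => /forallNP hl.
have eA : 0 < 1 / (2 * A%:R) :> R by rewrite divr_gt0 ?mulr_gt0 ?ltr0n.
have [N0 hN0] : exists N0, forall N, (N0 <= N)%N -> forall j,
    forall d (T : measurableType d) (P : probability T R) (X : nat -> T -> config A),
    is_urn F (u_init chi N) P X -> (P (unbounded j X) <= (1 / (2 * A%:R))%:E)%E.
  by apply: eventually_forall => j; exact: (contrapT (hl j)).
have N1 : (0 < N0.+1)%N by [].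
have [d [T [P [X hX]]]] := urn_exists hchi N1.
apply: (unbounded_not_all_unlikely (u_init_pos hchi N1) hX) => j.
exact: (hN0 N0.+1).
Qed.

Lemma attraction_domain_disjoint i j : i != j ->
  attraction_domain F i `&` attraction_domain F j = set0.
Proof.
move=> ij; apply/seteqP; split=> // chi [[hchi hi] [_ hj]].
have [N1 h1] := hi (1 / 2) ltac:(lra).
have [N2 h2] := hj (1 / 2) ltac:(lra).
pose N := (N1 + N2).+1; have N0 : (0 < N)%N by [].
have [d [T [P [X hX]]]] := urn_exists hchi N0.
have a := h1 N ltac:(rewrite /N; lia) _ _ _ _ hX.
have b := h2 N ltac:(rewrite /N; lia) _ _ _ _ hX.
have := lt_le_trans (lteD a b) (prob_sMon_sum (u_init_pos hchi N0) hX ij).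
by rewrite -EFinD lte_fin; lra.
Qed.

End AttractionDomains.

(** * Tail sums and the supermartingale bound *)

Section TailSums.
Variables (R : realType) (A : nat) (F : feedback R A).
Hypothesis F0 : feedback_pos F.
Implicit Types (i j : 'I_A).

(** Condition (M) sums from index 1. Dropping terms reaches every later start and adding one reaches
    index 0, so all tails converge together. *)
Lemma u_tail_rec i : cond_M F i -> forall k,
  cvgn (series (fun l => (F i (k + l)%:R)^-1)) /\
  u_tail F i k = (F i k%:R)^-1 + u_tail F i k.+1.
Proof.
move=> hM; pose u k l : R := (F i (k + l)%:R)^-1.
have uS k : series (u k.+1) = fun n => series (u k) n.+1 - (F i k%:R)^-1.
  apply/funext => n; rewrite /series /= big_nat_recl //= /u addn0 addrC addKr.
  by apply: eq_bigr => l _; rewrite addSnnS.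
have down k : cvgn (series (u k.+1)) -> cvgn (series (u k)).
  move=> c; apply/cvg_ex; exists (limn (series (u k.+1)) + (F i k%:R)^-1).
  rewrite -cvg_shiftS.
  have -> : (fun n => series (u k) n.+1) = (fun n => series (u k.+1) n + (F i k%:R)^-1).
    by apply/funext => n; rewrite uS subrK.
  by apply: cvgD => //; exact: cvg_cst.
have up k : cvgn (series (u k)) ->
    series (u k.+1) @ \oo --> limn (series (u k)) - (F i k%:R)^-1.
  by move=> c; rewrite uS; apply: cvgB; [rewrite cvg_shiftS|exact: cvg_cst].
have c1 : cvgn (series (u 1%N)) by [].
have ck k : cvgn (series (u k)).
  case: k => [|k]; first exact: down.
  by elim: k => // k /up c; apply/cvg_ex; eexists; exact: c.
move=> k; split; first exact: ck.
have := cvg_lim (@Rhausdorff R) (up k (ck k)).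
by rewrite /u_tail -/(u k) -/(u k.+1) => ->; rewrite addrC subrK.
Qed.

Lemma u_tailS i k : cond_M F i -> u_tail F i k.+1 = u_tail F i k - (F i k%:R)^-1.
Proof. by move=> hM; rewrite [u_tail F i k](u_tail_rec hM k).2 addrC addKr. Qed.

Lemma invF_gt0 i k : (0 < k)%N -> 0 < (F i k%:R)^-1.
Proof. by move=> k0; rewrite invr_gt0 F0 ?ltr0n. Qed.

Lemma u_tail_le i k l : cond_M F i -> (0 < k)%N -> (k <= l)%N ->
  u_tail F i l <= u_tail F i k.
Proof.
move=> hM k0 /subnK <-; elim: (l - k)%N => // m IH.
by apply: le_trans IH; rewrite addSn u_tailS // gerBl ltW // invF_gt0 // ltn_addl.
Qed.

Lemma u_tail_gt0 i k : cond_M F i -> (0 < k)%N -> 0 < u_tail F i k.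
Proof.
move=> hM k0; rewrite (u_tail_rec hM k).2 ltr_pwDl ?invF_gt0 //.
apply: limr_ge; first exact: (u_tail_rec hM k.+1).1.
apply: nearW => n; apply: sumr_ge0 => l _.
by rewrite ltW // invF_gt0.
Qed.

Lemma inv_le_u_tail i k : cond_M F i -> (0 < k)%N -> (F i k%:R)^-1 <= u_tail F i k.
Proof.
by move=> hM k0; rewrite (u_tail_rec hM k).2 lerDl ltW // u_tail_gt0.
Qed.

Lemma u_tail_sum i k l : cond_M F i -> (k <= l)%N ->
  \sum_(k <= m < l) (F i m%:R)^-1 = u_tail F i k - u_tail F i l.
Proof.
move=> hM /subnK <-; elim: (l - k)%N => [|m IH].
  by rewrite add0n big_geq // subrr.
rewrite addSn big_nat_recr ?leq_addl //= IH u_tailS //; ring.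
Qed.

Lemma u_tail_cvg0 i : cond_M F i -> u_tail F i @ \oo --> 0.
Proof.
move=> hM; rewrite -cvg_shiftS.
have -> : (fun k => u_tail F i k.+1) =
    (fun k => u_tail F i 1%N - series (fun l => (F i (1 + l)%:R)^-1) k).
  apply/funext => k; have := u_tail_sum hM (ltn0Sn k).
  rewrite big_add1 /= => e; rewrite /series /=.
  under eq_bigr do rewrite add1n.
  by rewrite e opprB addrC subrK.
have := cvgB (cvg_cst (u_tail F i 1%N)) (u_tail_rec hM 1%N).1.
by rewrite subrr; apply.
Qed.

Lemma u_tail_small i (e : R) k : cond_M F i -> 0 < e ->
  exists2 L, (k <= L)%N & u_tail F i L <= e.
Proof.
move=> hM e0; have /cvgrPdist_le /(_ e e0) [n _ hn] := u_tail_cvg0 hM.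
exists (n + k)%N; first exact: leq_addl.
have := hn (n + k)%N (leq_addr _ _); rewrite sub0r normrN.
by apply: le_trans; exact: ler_norm.
Qed.

(** Bounded partial sums of positive terms would make the series of (M) converge. *)
Lemma sum_invF_unbounded i (K : R) k : ~ cond_M F i -> (0 < k)%N ->
  exists2 L, (k <= L)%N & K <= \sum_(k <= m < L) (F i m%:R)^-1.
Proof.
move=> nM k0; apply: contrapT => nL; apply: nM.
have bnd L : (k <= L)%N -> \sum_(k <= m < L) (F i m%:R)^-1 < K.
  by move=> kL; rewrite ltNge; apply/negP => h; apply: nL; exists L.
apply: nondecreasing_is_cvgn.
  by apply/nondecreasing_seqP => n; rewrite !seriesEnat /= big_nat_recr //= lerDl ltW // invF_gt0.
exists (\sum_(1 <= m < k) (F i m%:R)^-1 + K) => _ [n _ <-].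
rewrite seriesEnat /=.
have -> : \sum_(0 <= l < n) (F i l.+1%:R)^-1 = \sum_(1 <= m < n.+1) (F i m%:R)^-1.
  by rewrite big_add1.
apply: (@le_trans _ _ (\sum_(1 <= m < n.+1 + k) (F i m%:R)^-1)).
  rewrite (@big_cat_nat _ _ _ n.+1 1 (n.+1 + k)) ?leq_addr //= lerDl.
  rewrite big_seq_cond sumr_ge0 // => m; rewrite mem_index_iota => /andP[/andP[nm _] _].
  by rewrite ltW // invF_gt0 // (leq_trans _ nm).
rewrite (@big_cat_nat _ _ _ k 1 (n.+1 + k)) ?leq_addl //= lerD2l ltW //.
by rewrite bnd // leq_addl.
Qed.

End TailSums.

(** * Supermartingale bound for an unbounded agent *)

Section SupermartingaleBound.
Variables (R : realType) (A : nat) (F : feedback R A).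
Hypotheses (F0 : feedback_pos F) (A0 : (0 < A)%N).
Variables (x0 : config A) (d : measure_display) (T : measurableType d).
Variables (P : probability T R) (X : nat -> T -> config A).
Hypotheses (x0_pos : positive x0) (hX : is_urn F x0 P X).

(* With g and v the moment generating functions of the explosion time of agent i and
   of minus that of agent j in the exponential embedding, [g (x i) * v (x j)] would be
   a martingale; only the two one-step inequalities matter. *)
Lemma prob_unbounded_supermartingale i j (theta : R) (g v : nat -> R) L :
  i != j ->
  (forall m, (x0 i <= m)%N -> 1 <= g m) ->
  (forall m, (x0 i <= m)%N -> F i m%:R * (g m.+1 - g m) <= - (theta * g m)) ->
  (forall m, (x0 j <= m)%N -> 0 < v m) ->
  (forall m, (x0 j <= m)%N -> v m <= v m.+1) ->
  (forall m, (x0 j <= m)%N -> F j m%:R * (v m.+1 - v m) <= theta * v m) ->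
  (x0 j <= L)%N ->
  (P (unbounded j X) <= (g (x0 i) * v (x0 j) / v L)%:E)%E.
Proof.
move=> ij g1 gS v0 v_le vS jL.
have v_mono m n : (x0 j <= m)%N -> (m <= n)%N -> v m <= v n.
  move=> jm /subnK <-; elim: (n - m)%N => // k IH.
  by apply: (le_trans IH); rewrite addSn v_le // (leq_trans jm) ?leq_addl.
(* The truncation by [maxn] makes [phi] nonnegative everywhere, as Markov's inequality demands,
   although g and v are controlled only from the initial counts on. *)
pose phi (y : config A) := g (maxn (x0 i) (y i)) * v (maxn (x0 j) (y j)) / v L.
have -> : g (x0 i) * v (x0 j) / v L = phi x0 by rewrite /phi !maxnn.
apply: (@prob_unbounded_le _ _ _ F0 A0 _ _ _ _ _ x0_pos hX _ L) => n.
apply: (le_trans (@prob_config_le _ _ _ F0 A0 _ _ _ _ _ x0_pos hX n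
  [set y : config A | (L <= y j)%N] phi _ _)).
- move=> y; rewrite /phi; apply: divr_ge0; last exact/ltW/v0.
  apply: mulr_ge0; last by apply/ltW/v0; exact: leq_maxl.
  by apply: (le_trans ler01); apply: g1; exact: leq_maxl.
- move=> y /= Ly; rewrite /phi ler_pdivlMr ?v0 // mul1r.
  apply: (@le_trans _ _ (v (maxn (x0 j) (y j)))).
    by apply: v_mono => //; rewrite leq_max Ly orbT.
  by rewrite ler_peMl ?g1 ?leq_maxl // ltW // v0 // leq_maxl.
rewrite lee_fin; apply: supermartingale_urn_mean => // y xy.
rewrite (bigD1 i) //= (bigD1 j) /=; last by rewrite eq_sym.
rewrite [X in _ + (_ + X)]big1 ?addr0; last first.
  move=> k /andP[ki kj]; rewrite /phi !ffunE eq_sym (negbTE ki) eq_sym (negbTE kj).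
  by rewrite !addn0 subrr mulr0.
rewrite /phi !ffunE !eqxx (negbTE ij) eq_sym (negbTE ij) !addn0 !addn1.
have mi : maxn (x0 i) (y i) = y i by apply/maxn_idPr.
have mj : maxn (x0 j) (y j) = y j by apply/maxn_idPr.
have mi' : maxn (x0 i) (y i).+1 = (y i).+1 by apply/maxn_idPr; exact: leqW.
have mj' : maxn (x0 j) (y j).+1 = (y j).+1 by apply/maxn_idPr; exact: leqW.
rewrite mi mj mi' mj' -!mulrBl -mulrBr.
have g0 : 0 <= g (y i) by apply: (le_trans ler01); exact: g1.
(* The drift coming from i is at most -theta g v and that from j at most theta g v; together they
   are at most 0. *)
have h1 := ler_wpM2r (ltW (v0 _ (xy j))) (gS _ (xy i)).
have h2 := ler_wpM2l g0 (vS _ (xy j)).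
rewrite !mulrA -mulrDl pmulr_lle0 ?invr_gt0 ?v0 //.
move: h1 h2; lra.
Qed.

End SupermartingaleBound.

(** * Criteria for losing *)

(** Follows from [1 + y <= expR y] at [y = (1 + delta) * x]. In the Chernoff bound the margin delta
    absorbs the second-order term and turns exponential steps into the linear supermartingale
    inequalities. *)
Lemma expRN_le_1B (R : realType) (delta x : R) : 0 < delta -> 0 <= x -> x <= delta / 2 ->
  delta <= 1 -> expR (- ((1 + delta) * x)) <= 1 - x.
Proof.
move=> d0 x0 xd d1; rewrite expRN; apply: (@le_trans _ _ (1 + (1 + delta) * x)^-1).
  rewrite lef_pV2 ?posrE ?expR_gt0 ?expR_ge1Dx //.
  by rewrite ltr_pwDl // mulr_ge0 // addr_ge0 // ltW.
have y0 : 0 < 1 + (1 + delta) * x by rewrite ltr_pwDl // mulr_ge0 // addr_ge0 // ltW.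
rewrite -div1r ler_pdivrMr //.
have : 0 <= x * (delta - (1 + delta) * x).
  by apply: mulr_ge0 => //; rewrite subr_ge0; nra.
lra.
Qed.

Lemma expR_le_1D (R : realType) (delta x : R) : 0 < delta -> 0 <= x -> x <= delta / 2 ->
  delta <= 1 -> expR ((1 - delta) * x) <= 1 + x.
Proof.
move=> d0 x0 xd d1; rewrite -[(1 - delta) * x]opprK expRN.
have y0 : 0 < 1 - (1 - delta) * x by nra.
apply: (@le_trans _ _ (1 - (1 - delta) * x)^-1).
  by rewrite lef_pV2 ?posrE ?expR_gt0 ?expR_ge1Dx.
rewrite -div1r ler_pdivrMr //.
have : 0 <= x * (delta - (1 - delta) * x) by apply: mulr_ge0 => //; nra.
lra.
Qed.

Section LosingCriteria.
Variables (R : realType) (A : nat) (F : feedback R A).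
Hypotheses (F0 : feedback_pos F) (A0 : (0 < A)%N).
Implicit Types (i j : 'I_A) (chi : pt R A).

Lemma u_init_large chi i (M : nat) : u_simplex_int chi ->
  exists N0, forall N, (N0 <= N)%N -> (M <= u_init chi N i)%N.
Proof.
move=> [chi0 _]; have := truncnS_gt (M%:R / chi i); set n := Num.truncn _ => hn.
exists n.+1 => N nN; rewrite ffunE.
have : M%:R <= chi i * N%:R.
  rewrite mulrC -ler_pdivrMr //; apply: (le_trans (ltW hn)).
  by rewrite ler_nat.
move=> h; rewrite -lez_nat gez0_abs ?ceil_ge0; last first.
  by apply: lt_le_trans (_ : 0 <= _); rewrite ?ltrN10 // (le_trans _ h).
by rewrite -(ler_int R) (le_trans _ (ceil_ge _)).
Qed.

(** A first-order Chernoff bound: [v] is affine in the sums of j and [g] is the inverse of an affine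
    function of those of i. Agent j enters through partial sums, so one criterion serves convergent
    and divergent sums alike. *)
Lemma loses_if_partial_sums i j chi : i != j -> cond_M F i -> u_simplex_int chi ->
  (forall K : R, exists N0, forall N, (N0 <= N)%N ->
    exists2 L, (u_init chi N j <= L)%N &
      K * u_tail F i (u_init chi N i) <=
      \sum_(u_init chi N j <= m < L) (F j m%:R)^-1) ->
  loses F j chi.
Proof.
(* The final bound is [2 / v L] with [v L >= K / 2]; the choice K = 4 / eps makes it at most eps. *)
move=> ij hM hchi h eps eps0; have [N0 hN0] := h (4 / eps).
exists N0.+1 => N NN d T P X hX.
have NN0 : (N0 <= N)%N by exact: ltnW.
have x_pos := u_init_pos hchi (leq_ltn_trans (leq0n _) NN).
set x := u_init chi N in x_pos hX *; have [L jL hL] := hN0 N NN0.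
rewrite -/x in jL hL.
set S := u_tail F i in hL *; have S0 : 0 < S (x i) by apply: u_tail_gt0.
(* This parameter keeps [th * S m] at most 1 / 2, so that [g] stays between 1 and 2. *)
pose th := (2 * S (x i))^-1.
have th0 : 0 < th by rewrite invr_gt0 mulr_gt0.
have Smax m : (x i <= m)%N -> S m <= S (x i) by move=> xm; apply: u_tail_le.
have Spos m : (x i <= m)%N -> 0 < S m.
  by move=> xm; apply: u_tail_gt0 => //; exact: leq_trans xm.
have thS : th * S (x i) = 1 / 2.
  by rewrite /th; field; rewrite gt_eqF.
have thSm m : (x i <= m)%N -> 0 < th * S m <= 1 / 2.
  by move=> xm; rewrite mulr_gt0 ?Spos //= -thS ler_pM2l // Smax.
pose g m := (1 - th * S m)^-1.
pose v l := 1 + th * \sum_(x j <= m < l) (F j m%:R)^-1.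
have fj m : (x j <= m)%N -> 0 < (F j m%:R)^-1.
  by move=> xm; rewrite invF_gt0 // (leq_trans _ xm).
have vS m : (x j <= m)%N -> v m.+1 = v m + th * (F j m%:R)^-1.
  by move=> xm; rewrite /v big_nat_recr //= mulrDr addrA.
have v1 m : (x j <= m)%N -> 1 <= v m.
  move=> xm; rewrite lerDl mulr_ge0 ?(ltW th0) // big_seq_cond sumr_ge0 // => k.
  by rewrite mem_index_iota => /andP[/andP[xk _] _]; rewrite ltW // fj.
apply: (le_trans (@prob_unbounded_supermartingale _ _ _ F0 A0 x _ _ P X x_pos hX
  i j th g v L ij _ _ _ _ _ jL)).
- move=> m /thSm /andP[h1 h2].
  by rewrite -[leLHS]invr1 lef_pV2 ?posrE //; lra.
- move=> m xm; have /andP[h1 h2] := thSm m xm.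
  have /andP[h3 h4] := thSm m.+1 (leqW xm).
  have Fm : 0 < F i m%:R by rewrite F0 ?ltr0n // (leq_trans _ xm).
  have eS : S m = (F i m%:R)^-1 + S m.+1 by exact: (u_tail_rec hM m).2.
  have d1 : 0 < 1 - th * S m by lra.
  have d2 : 0 < 1 - th * S m.+1 by lra.
  have -> : F i m%:R * (g m.+1 - g m) = - (th * g m) * (1 - th * S m.+1)^-1.
    have eth : th = ((1 - th * S m.+1) - (1 - th * S m)) * F i m%:R.
      by rewrite eS; field; rewrite gt_eqF.
    have alg (a b D1 D2 : R) : 0 < D1 -> 0 < D2 -> a = (D2 - D1) * b ->
        b * (D2^-1 - D1^-1) = - (a * D1^-1) * D2^-1.
      by move=> p1 p2 ->; field; rewrite !gt_eqF.
    exact: alg.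
  rewrite mulNr lerN2 ler_peMr //.
    by rewrite mulr_ge0 ?(ltW th0) // invr_ge0 ltW.
  by rewrite -[leLHS]invr1 lef_pV2 ?posrE //; lra.
- by move=> m /v1; apply: lt_le_trans.
- by move=> m xm; rewrite vS // lerDl mulr_ge0 // ltW // fj.
- move=> m xm; rewrite vS // addrC addKr mulrCA mulfV; last first.
    by rewrite -invr_eq0 gt_eqF // fj.
  by rewrite ler_pM2l // v1.
rewrite lee_fin.
have -> : g (x i) = 2 by rewrite /g thS; field.
have -> : v (x j) = 1 by rewrite /v big_geq // mulr0 addr0.
rewrite mulr1 ler_pdivrMr; last exact: (lt_le_trans ltr01 (v1 _ jL)).
rewrite /v mulrC -ler_pdivrMr // -[leLHS]add0r lerD //.
have := ler_wpM2l (ltW th0) hL.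
rewrite mulrCA thS; apply: le_trans.
by rewrite le_eqVlt; apply/orP; left; apply/eqP; field; rewrite gt_eqF.
Qed.

Lemma loses_if_not_cond_M i j chi : i != j -> cond_M F i -> ~ cond_M F j ->
  u_simplex_int chi -> loses F j chi.
Proof.
move=> ij hM nM hchi; apply: (loses_if_partial_sums ij hM hchi) => K.
exists 1%N => N N1; have := u_init_pos hchi N1; set x := u_init chi N => x_pos.
by have [L ? ?] := sum_invF_unbounded F0 (K * u_tail F i (x i)) nM (x_pos j); exists L.
Qed.

Lemma loses_if_tail_negligible i j chi : i != j -> cond_M F i -> cond_M F j ->
  u_simplex_int chi ->
  (forall delta : R, 0 < delta -> exists N0, forall N, (N0 <= N)%N ->
    u_tail F i (u_init chi N i) <= delta * u_tail F j (u_init chi N j)) ->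
  loses F j chi.
Proof.
move=> ij hMi hMj hchi h; apply: (loses_if_partial_sums ij hMi hchi) => K.
pose K' := Num.max K 1; have K0 : 0 < K' by rewrite lt_max ltr01 orbT.
have [|N0 hN0] := h (2 * K')^-1; first by rewrite invr_gt0 mulr_gt0.
exists N0.+1 => N NN; have := hN0 N (ltnW NN).
have := u_init_pos hchi (leq_ltn_trans (leq0n _) NN).
set x := u_init chi N => x_pos hx.
have Sj : 0 < u_tail F j (x j) by apply: u_tail_gt0.
have Si : 0 < u_tail F i (x i) by apply: u_tail_gt0.
(* Past [L] at most half of the tail of j remains, so the partial sum up to [L] carries at least the
   other half; hence the 2 in [2 * K']. *)
have [L jL hL] := @u_tail_small _ _ F j (u_tail F j (x j) / 2) (x j) hMj ltac:(lra).
exists L => //; rewrite u_tail_sum //.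
apply: (@le_trans _ _ (K' * u_tail F i (x i))).
  by rewrite ler_pM2r // le_max lexx.
apply: (@le_trans _ _ (u_tail F j (x j) / 2)); last by lra.
rewrite -ler_pdivlMl //; apply: (le_trans hx).
by rewrite le_eqVlt; apply/orP; left; apply/eqP; field; rewrite gt_eqF.
Qed.

Lemma type_P_large i (K : R) : type_P F i ->
  exists k0, forall k, (k0 <= k)%N -> K <= F i k%:R * u_tail F i k.
Proof.
move=> [_ /cvgryPge /(_ K) [k0 _ h]]; exists k0 => k kk; exact: h.
Qed.

(* Chernoff bound for the explosion times, which for type P agents concentrate at the tail sums. *)
Lemma loses_if_type_P i j chi (rho : R) : i != j -> type_P F i -> type_P F j ->
  u_simplex_int chi -> rho < 1 ->
  (exists N0, forall N, (N0 <= N)%N ->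
    u_tail F i (u_init chi N i) <= rho * u_tail F j (u_init chi N j)) ->
  loses F j chi.
Proof.
move=> ij Pi Pj hchi rho1 [N0 hN0] eps eps0.
have [hMi _] := Pi; have [hMj _] := Pj.
(* With r the nonnegative part of rho, the margin 1 - r equals 2c; [delta] and the remainder [c / 4]
   allowed at [L] are small against it. *)
pose c := (1 - Num.max rho 0) / 2.
have r0 : 0 <= Num.max rho 0 by rewrite le_max lexx orbT.
have r1 : Num.max rho 0 < 1 by rewrite gt_max rho1 ltr01.
have rr : rho <= Num.max rho 0 by rewrite le_max lexx.
set r := Num.max rho 0 in c r0 r1 rr.
have c0 : 0 < c by rewrite /c; lra.
pose delta := c / 2; have delta0 : 0 < delta by rewrite /delta; lra.
have delta1 : delta <= 1 by rewrite /delta /c; lra.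
(* Chosen so that [K * c / 2] is 1 / eps, since [expR (- eps^-1) <= eps]. *)
pose K := 2 / (c * eps); have K0 : 0 < K by rewrite divr_gt0 // mulr_gt0.
(* Type P makes single terms small against the tail, which keeps the increments [th / F] at most
   [delta / 2], where the exponential estimates hold. *)
have [ki hki] := type_P_large (2 * K / delta) Pi.
have [kj hkj] := type_P_large (2 * K / delta) Pj.
have [Ni hNi] := u_init_large i ki hchi.
have [Nj hNj] := u_init_large j kj hchi.
exists (N0 + Ni + Nj).+1 => N NN d T P X hX.
have x_pos := u_init_pos hchi (leq_ltn_trans (leq0n _) NN).
have := hN0 N ltac:(lia); have := hNi N ltac:(lia); have := hNj N ltac:(lia).
set x := u_init chi N in x_pos hX * => xj xi hx.
set Si := u_tail F i in hki hx *; set Sj := u_tail F j in hkj hx *.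
have Sj0 m : (x j <= m)%N -> 0 < Sj m.
  by move=> xm; apply: u_tail_gt0 => //; exact: leq_trans xm.
have Si0 m : (x i <= m)%N -> 0 < Si m.
  by move=> xm; apply: u_tail_gt0 => //; exact: leq_trans xm.
pose th := K / Sj (x j); have th0 : 0 < th by rewrite divr_gt0 ?Sj0.
have small k m (S : nat -> R) : S m <= Sj (x j) -> 0 < S m -> 0 < F k m%:R ->
    2 * K / delta <= F k m%:R * S m -> th / F k m%:R <= delta / 2.
  move=> Sm S0 Fm h; rewrite /th -mulrA -invfM ler_pdivrMr ?mulr_gt0 ?Sj0 //.
  have : 2 * K / delta <= F k m%:R * Sj (x j).
    by apply: (le_trans h); rewrite ler_pM2l.
  rewrite ler_pdivrMr // => h'; rewrite mulrC [Sj _ * _]mulrC; lra.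
have smalli m : (x i <= m)%N -> th / F i m%:R <= delta / 2.
  move=> xm; apply: (small i m Si); rewrite ?Si0 //.
  - apply: (@le_trans _ _ (Si (x i))); first exact: u_tail_le.
    apply: (le_trans hx); apply: (@le_trans _ _ (r * Sj (x j))).
      by rewrite ler_pM2r // Sj0.
    by rewrite ger_pMl ?Sj0 // ltW.
  - by rewrite F0 ?ltr0n // (leq_trans _ xm).
  - by apply: hki; exact: leq_trans xm.
have smallj m : (x j <= m)%N -> th / F j m%:R <= delta / 2.
  move=> xm; apply: (small j m Sj); rewrite ?Sj0 //.
  - exact: u_tail_le.
  - by rewrite F0 ?ltr0n // (leq_trans _ xm).
  - by apply: hkj; exact: leq_trans xm.
have [L jL hL] := @u_tail_small _ _ F j (Sj (x j) * (c / 4)) (x j) hMj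
  ltac:(apply: mulr_gt0; [exact: Sj0|lra]).
rewrite -/Sj in hL.
pose g m := expR ((1 + delta) * (th * Si m)).
pose v m := expR (- ((1 - delta) * (th * Sj m))).
have key k (S : nat -> R) m : S m = (F k m%:R)^-1 + S m.+1 ->
    th * S m.+1 = th * S m - th / F k m%:R by move=> ->; ring.
have x_ge0 k m : (x k <= m)%N -> 0 <= th / F k m%:R.
  move=> xm; apply: divr_ge0; first exact: ltW.
  by rewrite ltW // F0 // ltr0n (leq_trans _ xm).
have Fn0 k m : (x k <= m)%N -> 0 < F k m%:R.
  by move=> xm; rewrite F0 // ltr0n (leq_trans _ xm).
have gS m : (x i <= m)%N -> g m.+1 = g m * expR (- ((1 + delta) * (th / F i m%:R))).
  move=> xm; rewrite /g (key i Si m (u_tail_rec hMi m).2) -expRD; congr expR; ring.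
have vS m : (x j <= m)%N -> v m.+1 = v m * expR ((1 - delta) * (th / F j m%:R)).
  move=> xm; rewrite /v (key j Sj m (u_tail_rec hMj m).2) -expRD; congr expR; ring.
apply: (le_trans (@prob_unbounded_supermartingale _ _ _ F0 A0 x _ _ P X x_pos hX
  i j th g v L ij _ _ _ _ _ jL)).
- move=> m xm; rewrite /g -[leLHS]expR0 ler_expR.
  apply: mulr_ge0; first by rewrite addr_ge0 // ltW.
  exact: (mulr_ge0 (ltW th0) (ltW (Si0 _ xm))).
- move=> m xm; rewrite gS //.
  have := expRN_le_1B delta0 (x_ge0 i m xm) (smalli m xm) delta1.
  set e := expR _ => he.
  have -> : F i m%:R * (g m * e - g m) = (F i m%:R * g m) * (e - 1) by ring.
  have -> : - (th * g m) = (F i m%:R * g m) * (- (th / F i m%:R)).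
    by field; rewrite gt_eqF ?Fn0.
  rewrite ler_wpM2l //; last by lra.
  exact: (mulr_ge0 (ltW (Fn0 _ _ xm)) (expR_ge0 _)).
- by move=> m xm; exact: expR_gt0.
- move=> m xm; rewrite vS // ler_peMr ?expR_ge0 // -[leLHS]expR0 ler_expR.
  by apply: mulr_ge0; [rewrite subr_ge0 | exact: x_ge0].
- move=> m xm; rewrite vS //.
  have := expR_le_1D delta0 (x_ge0 j m xm) (smallj m xm) delta1.
  set e := expR _ => he.
  have -> : F j m%:R * (v m * e - v m) = (F j m%:R * v m) * (e - 1) by ring.
  have -> : th * v m = (F j m%:R * v m) * (th / F j m%:R).
    by field; rewrite gt_eqF ?Fn0.
  rewrite ler_wpM2l //; last by lra.
  exact: (mulr_ge0 (ltW (Fn0 _ _ xm)) (expR_ge0 _)).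
rewrite lee_fin /g /v -expRN -!expRD opprK.
set E := (X in expR X); suff hE : E <= - (K * c / 2).
  apply: (@le_trans _ _ (expR (- (K * c / 2)))); first by rewrite ler_expR.
  rewrite expRN -[leRHS]invrK lef_pV2 ?posrE ?expR_gt0 ?invr_gt0 //.
  apply: le_trans (expR_ge1Dx _).
  have -> : K * c / 2 = eps^-1 by rewrite /K; field; rewrite !gt_eqF.
  by rewrite lerDr.
have hi : th * Si (x i) <= K * r.
  rewrite /th -mulrA ler_pM2l // mulrC ler_pdivrMr ?Sj0 //.
  by apply: (le_trans hx); rewrite ler_pM2r // Sj0.
have hj : th * Sj (x j) = K by rewrite /th divfK // gt_eqF // Sj0.
have hl : th * Sj L <= K * (c / 4).
  by rewrite -hj -mulrA ler_pM2l.
have hl0 : 0 <= th * Sj L by exact: (mulr_ge0 (ltW th0) (ltW (Sj0 _ jL))).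
have hi0 : 0 <= th * Si (x i) by exact: (mulr_ge0 (ltW th0) (ltW (Si0 _ (leqnn _)))).
have -> : E = (1 + delta) * (th * Si (x i)) - (1 - delta) * K
    + (1 - delta) * (th * Sj L).
  by rewrite /E hj.
have a1 : (1 + delta) * (th * Si (x i)) <= (1 + delta) * (K * r).
  by rewrite ler_pM2l // addr_gt0.
have a2 : (1 - delta) * (th * Sj L) <= K * (c / 4).
  apply: le_trans hl; apply: ler_piMl => //; rewrite gerBl; exact: ltW.
have a3 : (1 + delta) * (K * r) - (1 - delta) * K + K * (c / 4) =
    K * ((1 + delta) * r - (1 - delta) + c / 4) by ring.
have a4 : (1 + delta) * r - (1 - delta) + c / 4 <= - (c / 2).
  by rewrite /delta /c; nra.
have a5 : K * ((1 + delta) * r - (1 - delta) + c / 4) <= K * (- (c / 2)).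
  by rewrite ler_pM2l.
lra.
Qed.

End LosingCriteria.

(** * Comparison of tail sums *)

Section Limsup.
Variable R : realType.
Implicit Types u : nat -> \bar R.

Lemma limn_esup_lt u c : (limn_esup u < c)%E ->
  exists n0, forall n, (n0 <= n)%N -> (u n < c)%E.
Proof.
move=> /ereal_inf_lt[_ [V [n0 _ hV] <-] h]; exists n0 => n n0n.
apply: le_lt_trans h; apply: ereal_sup_ubound; exists n => //.
exact: hV.
Qed.

Lemma limn_esup_le u c n0 : (forall n, (n0 <= n)%N -> (u n <= c)%E) ->
  (limn_esup u <= c)%E.
Proof.
move=> h; apply: (@le_trans _ _ (ereal_sup [set u n | n in [set n | (n0 <= n)%N]])).
  apply: ereal_inf_lbound; exists [set n | (n0 <= n)%N] => //.
  exact: nbhs_infty_ge.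
by apply: ge_ereal_sup => _ [n n0n <-]; exact: h.
Qed.

Lemma limn_esup_bounded (u : nat -> R) : (limn_esup (fun n => (u n)%:E) < +oo)%E ->
  exists2 C, 0 < C & exists n0, forall n, (n0 <= n)%N -> u n <= C.
Proof.
move=> h; have [c hc] : exists c : R, (limn_esup (fun n => (u n)%:E) < c%:E)%E.
  case: (limn_esup _) h => [r|//|] _; first by exists (r + 1); rewrite lte_fin ltrDl.
  by exists 0; rewrite ltNyr.
exists (Num.max c 1); first by rewrite lt_max ltr01 orbT.
have [n0 h0] := limn_esup_lt hc; exists n0 => n /h0; rewrite lte_fin => /ltW uc.
by rewrite le_max uc.
Qed.

(** Turns the excluded coexistence of liminf 0 and infinite limsup into an eventual bound from one
    side. Index 0 is exempt because feedback at 0 is not controlled. *)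
Lemma einf_esup_dichotomy (u : nat -> R) : (forall n, (0 < n)%N -> 0 <= u n) ->
  ~ (limn_einf (fun n => (u n)%:E) = 0%E /\ limn_esup (fun n => (u n)%:E) = +oo%E) ->
  (exists2 c, 0 < c & exists n0, forall n, (n0 <= n)%N -> c <= u n) \/
  (exists2 C, 0 < C & exists n0, forall n, (n0 <= n)%N -> u n <= C).
Proof.
move=> u0 nn; have [e|e] := eqVneq (limn_esup (fun n => (u n)%:E)) +oo%E; last first.
  by right; apply: limn_esup_bounded; rewrite ltey.
left; have i0 : (0 <= limn_einf (fun n => (u n)%:E))%E.
  rewrite /limn_einf leeNr oppe0; apply: (@limn_esup_le _ _ 1) => n n1.
  by rewrite leeNl oppe0 lee_fin u0.
have : (0 < limn_einf (fun n => (u n)%:E))%E.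
  by rewrite lt_neqAle i0 andbT; apply/eqP => z; apply: nn.
move=> {}i0; have [c c0 hc] : exists2 c : R, 0 < c & (c%:E < limn_einf (fun n => (u n)%:E))%E.
  case: (limn_einf _) i0 => [r|_|//]; last by exists 1; rewrite // ltry.
  by rewrite lte_fin => r0; exists (r / 2); rewrite ?lte_fin; lra.
exists c => //; move: hc; rewrite /limn_einf lteNr => /limn_esup_lt[n0 h0].
exists n0 => n /h0; rewrite lteNr oppeK lte_fin; exact: ltW.
Qed.

End Limsup.

Lemma rational_between (R : realType) (a b : R) : 0 <= a -> a < b ->
  exists p q : nat, [/\ (0 < p)%N, (0 < q)%N, a < p%:R / q%:R & p%:R / q%:R < b].
Proof.
move=> a0 ab; set q := (Num.truncn (b - a)^-1).+1.
have hq : (b - a)^-1 < q%:R := truncnS_gt _.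
have q0 : 0 < q%:R :> R by rewrite ltr0n.
set p := (Num.truncn (a * q%:R)).+1; have hp : a * q%:R < p%:R := truncnS_gt _.
have hp' : p%:R <= a * q%:R + 1.
  by rewrite /p -natr1 lerD2r truncn_le mulr_ge0 // ltW.
exists p, q; split=> //; first by rewrite ltr_pdivlMr.
rewrite ltr_pdivrMr //; apply: (le_lt_trans hp').
rewrite -ltrBrDl -mulrBl -ltr_pdivrMl ?subr_gt0 // mulr1 //.
Qed.

(** * Decay of tail sums when the index is rescaled *)

Section Gaps.
Variables (R : realType) (A : nat) (F : feedback R A).
Hypothesis F0 : feedback_pos F.
Implicit Types (i j : 'I_A) (chi : pt R A).

Lemma u_init_bounds i chi N : u_simplex_int chi ->
  chi i * N%:R <= (u_init chi N i)%:R < chi i * N%:R + 1.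
Proof.
move=> [chi0 _]; have h0 : 0 <= chi i * N%:R by rewrite mulr_ge0 // ltW.
rewrite ffunE; set c := Num.ceil _.
have c0 : 0 <= c by rewrite ceil_ge0 (lt_le_trans _ h0) // ltrN10.
rewrite natr_absz ger0_norm // ceil_ge /= -ltrBlDr.
by have := ceilB1_lt (chi i * N%:R); rewrite -/c intrB.
Qed.

(** The tail sum shrinks by rho when its starting index grows by the factor sigma. Type E allows any
    rho > 0, type P with the growth bound some rho < 1; this pays for the constant lost in comparing
    two agents. *)
Definition tail_gap i (sigma rho : R) := exists m0, forall m, (m0 <= m)%N ->
  forall M, sigma * m%:R <= M%:R -> u_tail F i M <= rho * u_tail F i m.

Lemma type_E_bound i : type_E F i ->
  exists2 C, 1 < C & exists k0, forall k, (k0 < k)%N -> F i k%:R * u_tail F i k <= C.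
Proof.
move=> [_ /limn_esup_bounded[C C0 [k0 h]]]; exists (C + 1); first by rewrite ltrDr.
by exists k0 => k kk; rewrite (le_trans (h k (ltnW kk))) // lerDl.
Qed.

(** A bound C on the product of feedback and tail says that the first term is at least the fraction
    1 / C of the tail, so each step multiplies the tail by at most 1 - 1 / C. *)
Lemma type_E_geometric i : type_E F i -> exists g : R, [/\ 0 < g, g < 1 &
  exists k0, (0 < k0)%N /\ forall k n, (k0 <= k)%N ->
    u_tail F i (k + n) <= g ^+ n * u_tail F i k].
Proof.
move=> Ei; have [hM _] := Ei; have [C C1 [k0 hC]] := type_E_bound Ei.
have C0 : 0 < C by exact: lt_trans C1.
exists (1 - C^-1); split.
- by rewrite subr_gt0 invf_lt1.
- by rewrite gtrBl invr_gt0.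
have g0 : 0 <= 1 - C^-1 by rewrite subr_ge0 invf_le1 // ltW.
exists k0.+1; split=> // k n kk; elim: n => [|n IH].
  by rewrite addn0 expr0 mul1r.
rewrite addnS exprS -mulrA; apply: le_trans (ler_wpM2l g0 IH).
rewrite u_tailS // mulrBl mul1r lerD2l lerN2.
have kn : (k0 < k + n)%N by rewrite (leq_trans kk) ?leq_addr.
have Fk : 0 < F i (k + n)%:R by rewrite F0 // ltr0n (leq_trans _ kn).
rewrite ler_pdivrMl // ler_pdivlMr // mulrC.
exact: hC.
Qed.

Lemma type_E_gap i sigma delta : type_E F i -> 1 < sigma -> 0 < delta ->
  tail_gap i sigma delta.
Proof.
move=> Ei s1 d0; have [hM _] := Ei.
have [g [g0 g1 [k0 [k00 hg]]]] := type_E_geometric Ei.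
have /cvgrPdist_le /(_ delta d0) [n1 _ hn] : (fun n => g ^+ n) @ \oo --> 0.
  by apply: cvg_expr; rewrite gtr0_norm.
(* From this m on, [(sigma - 1) * m] covers the [n1] steps after which [g ^+ n1 <= delta]. *)
exists (k0 + (Num.truncn (n1%:R / (sigma - 1))).+1)%N => m hm M hM'.
have mk : (k0 <= m)%N by exact: leq_trans (leq_addr _ _) hm.
have m0 : (0 < m)%N by exact: leq_trans mk.
have nM : (m + n1 <= M)%N.
  rewrite -(ler_nat R); apply: le_trans hM'; rewrite natrD.
  have -> : sigma * m%:R = m%:R + (sigma - 1) * m%:R by ring.
  rewrite lerD2l mulrC -ler_pdivrMr ?subr_gt0 //.
  apply: (le_trans (ltW (truncnS_gt _))); rewrite ler_nat.
  by apply: leq_trans hm; rewrite leq_addl.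
apply: (le_trans (u_tail_le F0 hM _ nM)); first by rewrite addn_gt0 m0.
apply: (le_trans (hg m n1 mk)); rewrite ler_pM2r ?u_tail_gt0 //.
have := hn n1 (leqnn _); rewrite /= sub0r normrN; apply: le_trans.
exact: ler_norm.
Qed.

(** Write S for the tail. For l from m to M the growth bound gives 1 / F(l) >= S(l) / (C l) >= S(M)
    / (C M). At least (1 - 1 / sigma) M such terms add up to a fixed multiple of S(M), a lower bound
    for S(m) - S(M). *)
Lemma type_P_gap i sigma : cond_M F i ->
  (limn_esup (fun k : nat => ((k%:R)^-1 * F i k%:R * u_tail F i k)%:E) < +oo)%E ->
  1 < sigma -> exists rho, [/\ 0 < rho, rho < 1 & tail_gap i sigma rho].
Proof.
move=> hM /limn_esup_bounded[C C0 [k0 hC]] s1.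
have s0 : 0 < sigma by exact: lt_trans s1.
pose e := (1 - sigma^-1) / C.
have e0 : 0 < e by rewrite divr_gt0 // subr_gt0 invf_lt1.
exists (1 + e)^-1; split; first by rewrite invr_gt0 addr_gt0.
  by rewrite invf_lt1 ?addr_gt0 // ltrDl.
exists k0.+1 => m km M sM.
have m0 : (0 < m)%N by exact: leq_trans km.
have m0' : 0 < m%:R :> R by rewrite ltr0n.
have mM : (m <= M)%N.
  by rewrite -(ler_nat R); apply: le_trans sM; rewrite ler_peMl ?ltW.
have M0 : 0 < M%:R :> R by rewrite ltr0n (leq_trans m0).
rewrite ler_pdivlMl ?addr_gt0 //.
rewrite mulrDl mul1r -lerBrDl -u_tail_sum //.
have SM : 0 < u_tail F i M by rewrite u_tail_gt0 // (leq_trans m0).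
apply: (@le_trans _ _ (\sum_(m <= l < M) (u_tail F i M / (C * M%:R)))).
  rewrite sumr_const_nat -[leRHS]mulr_natr natrB //.
  rewrite /e; have -> : (1 - sigma^-1) / C * u_tail F i M =
      u_tail F i M / (C * M%:R) * (M%:R - sigma^-1 * M%:R).
    by field; rewrite !gt_eqF.
  rewrite ler_pM2l ?divr_gt0 ?mulr_gt0 // lerD2l lerN2.
  by rewrite ler_pdivlMl.
apply: ler_sum_nat => l /andP[ml lM].
have l0 : (0 < l)%N by exact: leq_trans ml.
have l0' : 0 < l%:R :> R by rewrite ltr0n.
have Fl : 0 < F i l%:R by rewrite F0.
have := hC l (leq_trans (ltnW km) ml); rewrite -mulrA ler_pdivrMl // => h.
rewrite -[leRHS]div1r ler_pdivlMr // mulrAC ler_pdivrMr ?mulr_gt0 // mul1r.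
apply: (@le_trans _ _ (F i l%:R * u_tail F i l)).
  by rewrite mulrC ler_pM2l // u_tail_le // ltnW.
by apply: (le_trans h); rewrite mulrC ler_pM2l // ler_nat ltnW.
Qed.

(* Moving off the ray of slope p / q gains the factor rho. *)
Lemma tail_transfer i j (p q : nat) (t sigma rho C : R) chi :
  cond_M F i -> cond_M F j -> (0 < p)%N -> (0 < q)%N -> 0 <= C -> 1 < sigma ->
  p%:R / q%:R * sigma < t ->
  (exists n0, forall n, (n0 <= n)%N -> u_tail F i (p * n) <= C * u_tail F j (q * n)) ->
  tail_gap j sigma rho -> u_simplex_int chi -> t * chi j <= chi i ->
  exists N0, forall N, (N0 <= N)%N ->
    u_tail F i (u_init chi N i) <= C * rho * u_tail F j (u_init chi N j).
Proof.
move=> hMi hMj p0 q0 C0 s1 pqt [n0 hn] [m0 hm] hchi tc.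
have s0 : 0 < sigma by exact: lt_trans s1.
have q0' : 0 < q%:R :> R by rewrite ltr0n.
have p0' : 0 < p%:R :> R by rewrite ltr0n.
set w := p%:R / q%:R in pqt; have w0 : 0 < w by rewrite divr_gt0.
have t0 : 0 < t by apply: lt_trans pqt; rewrite mulr_gt0.
set K := (Num.truncn ((p%:R + t) / (t - w * sigma))).+1.
have [N0 hN0] := u_init_large j (m0 + q * n0 + K + 1) hchi.
exists N0 => N NN; have := hN0 N NN; set m := u_init chi N j => hmm.
have mpos : (0 < m)%N by apply: leq_trans hmm; rewrite addn1.
have mR : 0 < m%:R :> R by rewrite ltr0n.
set k := u_init chi N i.
have km : t * (m%:R - 1) <= k%:R.
  have /andP[h1 _] := u_init_bounds i N hchi.
  have /andP[_ h2] := u_init_bounds j N hchi.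
  apply: le_trans h1; apply: (@le_trans _ _ (t * (chi j * N%:R))).
    by rewrite ler_pM2l // lerBlDr ltW.
  by rewrite mulrA ler_wpM2r.
(* [q * n] just passes [sigma * m], so the gap of j applies from m; the matching [p * n] stays at
   most k because [w * sigma < t], once m is large enough to absorb the rounding. *)
set n := (Num.truncn (sigma * m%:R / q%:R)).+1.
have n1 : sigma * m%:R <= (q * n)%:R.
  by rewrite natrM [leRHS]mulrC -ler_pdivrMr // ltW // truncnS_gt.
have n2 : (p * n)%:R <= w * sigma * m%:R + p%:R.
  have -> : w * sigma * m%:R + p%:R = p%:R * (sigma * m%:R / q%:R + 1).
    by rewrite /w; field; rewrite gt_eqF.
  rewrite natrM ler_pM2l // /n -natr1 lerD2r truncn_le //.
  by rewrite divr_ge0 ?mulr_ge0 // ltW.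
have pk : (p * n <= k)%N.
  rewrite -(ler_nat R); apply: (le_trans n2); apply: le_trans km.
  have : (p%:R + t) / (t - w * sigma) <= m%:R.
    apply: (le_trans (ltW (truncnS_gt _))).
    by rewrite ler_nat; apply: leq_trans hmm; rewrite -/K; lia.
  by rewrite ler_pdivrMr ?subr_gt0 //; lra.
have mqn : (m <= q * n)%N.
  by rewrite -(ler_nat R); apply: le_trans n1; rewrite ler_peMl ?ltW.
have nn0 : (n0 <= n)%N.
  rewrite -(leq_pmul2l q0); apply: leq_trans mqn; apply: leq_trans hmm.
  by rewrite -!addnA addnCA leq_addr.
have pn0 : (0 < p * n)%N by rewrite muln_gt0 p0.
apply: (le_trans (u_tail_le F0 hMi pn0 pk)); apply: (le_trans (hn n nn0)).
rewrite -mulrA ler_wpM2l //; apply: hm n1.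
by apply: leq_trans hmm; rewrite -!addnA leq_addr.
Qed.

End Gaps.

Section PairPoints.
Variables (R : realType) (A : nat).
Implicit Types (i j : 'I_A).

Definition pair_scale : nat := if A == 2%N then 1%N else 2%N.

(* A point of the open simplex putting i and j in the proportion a : 1 - a; the scale
   is 1 or 2 so that integer coordinates of i and j are reached along integers N. *)
Definition pair_pt i j (a : R) : pt R A := fun k =>
  if k == i then a / pair_scale%:R else if k == j then (1 - a) / pair_scale%:R
  else (1 - pair_scale%:R^-1) / (A - 2)%:R.

Lemma pair_scale_gt0 : (0 < pair_scale)%N.
Proof. by rewrite /pair_scale; case: eqP. Qed.

Lemma pair_pt_int i j a : i != j -> 0 < a < 1 -> u_simplex_int (pair_pt i j a).
Proof.
move=> ij /andP[a0 a1].
have c2 : #|[pred k : 'I_A | (k != i) && (k != j)]| = (A - 2)%N.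
  have := cardC (pred2 i j); rewrite card2 ij card_ord => e.
  transitivity #|predC (pred2 i j)|; last by rewrite -(addKn 2 #|_|) e.
  by apply: eq_card => k; rewrite !inE negb_or.
have A2 : (2 <= A)%N.
  have := cardC (pred2 i j); rewrite card2 ij card_ord => <-; exact: leq_addr.
have s0 : 0 < pair_scale%:R :> R by rewrite ltr0n pair_scale_gt0.
split=> [k|].
  rewrite /pair_pt; case: ifP => ki; first by rewrite divr_gt0.
  case: ifP => kj; first by rewrite divr_gt0 // subr_gt0.
  have lt2A : (2 < A)%N.
    rewrite -subn_gt0 -c2; apply/card_gt0P; exists k.
    by rewrite inE ki kj.
  rewrite divr_gt0 ?ltr0n ?subn_gt0 // subr_gt0 /pair_scale gtn_eqF //.
  by rewrite invf_lt1 // ltr1n.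
rewrite (bigD1 i) //= (bigD1 j) /=; last by rewrite eq_sym.
rewrite (eq_bigr (fun=> (1 - pair_scale%:R^-1) / (A - 2)%:R)); last first.
  by move=> k /andP[/negbTE ki /negbTE kj]; rewrite /pair_pt ki kj.
rewrite sumr_const c2 /pair_pt eqxx eq_sym (negbTE ij) eqxx -[X in _ + (_ + X)]mulr_natr.
rewrite /pair_scale; case: (A =P 2%N) => [->|nA] /=.
  have -> : 1%:R = 1 :> R by [].
  by rewrite subnn invr1 subrr mul0r mul0r addr0 !mulr1; ring.
have A0 : 0 < (A - 2)%:R :> R by rewrite ltr0n subn_gt0 ltn_neqAle A2 andbT; apply/eqP => e; apply: nA.
by field; rewrite gt_eqF.
Qed.

(** At this N the coordinates of i and j are exactly k and l, so hypotheses about points of the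
    simplex yield ratios at integer pairs. *)
Lemma pair_pt_ratio (F : feedback R A) i j (k l n : nat) : i != j -> (0 < k + l)%N ->
  n = (pair_scale * (k + l))%N ->
  u_ratio F (pair_pt i j (k%:R / (k + l)%:R)) i j n = F i k%:R / F j l%:R.
Proof.
move=> ij kl ->; rewrite /u_ratio /pair_pt eqxx eq_sym (negbTE ij) eqxx.
have s0 : pair_scale%:R != 0 :> R by rewrite pnatr_eq0 -lt0n pair_scale_gt0.
have kl0 : (k + l)%:R != 0 :> R by rewrite pnatr_eq0 -lt0n.
by congr (F i _ / F j _); rewrite natrM; move: kl0; rewrite natrD => kl0; field; rewrite ?s0.
Qed.

End PairPoints.

(** * Agents of type E against each other and against type P *)

Section DominationTypeE.
Variables (R : realType) (A : nat) (F : feedback R A).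
Hypotheses (F0 : feedback_pos F) (A0 : (0 < A)%N).
Implicit Types (i j : 'I_A) (chi : pt R A).

Lemma exists_factor (w t : R) : 0 < w -> w < t -> exists2 s, 1 < s & w * s < t.
Proof.
move=> w0 wt; exists ((1 + t / w) / 2).
  have : 1 < t / w by rewrite ltr_pdivlMr // mul1r.
  lra.
have -> : w * ((1 + t / w) / 2) = (w + t) / 2 by field; rewrite gt_eqF.
lra.
Qed.

(** A type E tail is comparable with its first term, so on the ray of slope p / q the tail of i is
    at most C / c times that of j. The gap of j, taken with rho = delta c / C, makes the quotient
    negligible beyond slope t. *)
Lemma type_E_loses i j (p q : nat) (t c : R) chi : i != j -> type_E F i -> type_E F j ->
  (0 < p)%N -> (0 < q)%N -> p%:R / q%:R < t -> 0 < c ->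
  (exists n0, forall n, (n0 <= n)%N -> c * F j (q * n)%:R <= F i (p * n)%:R) ->
  u_simplex_int chi -> t * chi j <= chi i -> loses F j chi.
Proof.
move=> ij Ei Ej p0 q0 pqt c0 [n0 hn] hchi tc.
have [hMi _] := Ei; have [hMj _] := Ej.
have w0 : 0 < p%:R / q%:R :> R by rewrite divr_gt0 ?ltr0n.
have [s s1 pqs] := exists_factor w0 pqt.
have [C C1 [k0 hC]] := type_E_bound Ei.
have C0 : 0 < C by exact: lt_trans C1.
apply: (loses_if_tail_negligible F0 A0 ij hMi hMj hchi) => delta d0.
have Cc : 0 < C / c by rewrite divr_gt0.
have gap := type_E_gap F0 Ej s1 (divr_gt0 d0 Cc).
have [|N0 hN0] := tail_transfer F0 hMi hMj p0 q0 (ltW Cc) s1 pqs _ gap hchi tc; last first.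
  exists N0 => N NN; apply: (le_trans (hN0 N NN)).
  by rewrite mulrCA mulfV ?mulr1 // gt_eqF.
exists (n0 + k0).+1 => n nn.
have pn : (0 < p * n)%N by rewrite muln_gt0 p0 (leq_ltn_trans _ nn).
have qn : (0 < q * n)%N by rewrite muln_gt0 q0 (leq_ltn_trans _ nn).
have Fi : 0 < F i (p * n)%:R by rewrite F0 ?ltr0n.
have Fj : 0 < F j (q * n)%:R by rewrite F0 ?ltr0n.
have h1 : F i (p * n)%:R * u_tail F i (p * n) <= C.
  by apply: hC; apply: (@leq_trans n); [exact: leq_ltn_trans (leq_addl _ _) nn|rewrite leq_pmull].
have h2 := hn n (ltnW (leq_ltn_trans (leq_addr _ _) nn)).
apply: (@le_trans _ _ (C / c * (F j (q * n)%:R)^-1)); last first.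
  by rewrite ler_pM2l // inv_le_u_tail.
rewrite -mulrA -invfM ler_pdivlMr ?mulr_gt0 //; apply: le_trans h1.
by rewrite mulrC ler_pM2r // u_tail_gt0.
Qed.

Lemma type_E_comparison i j (t t' : R) : i != j -> type_E F i -> type_E F j ->
  (forall chi : pt R A, u_simplex_int chi ->
     ~ (limn_einf (fun N => (u_ratio F chi i j N)%:E) = 0%E /\
        limn_esup (fun N => (u_ratio F chi i j N)%:E) = +oo%E)) ->
  0 < t -> t < t' ->
  (forall chi, u_simplex_int chi -> t' * chi j <= chi i -> loses F j chi) \/
  (forall chi, u_simplex_int chi -> chi i <= t * chi j -> loses F i chi).
Proof.
move=> ij Ei Ej hd t0 tt.
have [p [q [p0 q0 tpq pqt]]] := rational_between (ltW t0) tt.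
have pq0 : (0 < p + q)%N by rewrite addn_gt0 p0.
have p0' : 0 < p%:R :> R by rewrite ltr0n.
have q0' : 0 < q%:R :> R by rewrite ltr0n.
pose chi0 : pt R A := pair_pt i j (p%:R / (p + q)%:R).
have hchi0 : u_simplex_int chi0.
  apply: pair_pt_int => //; rewrite divr_gt0 ?ltr0n //=.
  by rewrite ltr_pdivrMr ?ltr0n // mul1r ltr_nat -addn1 leq_add2l.
(* Along multiples of [pair_scale A * (p + q)] the ratio at [chi0] is exactly the one on the
   rational ray, and eventual bounds pass to this subsequence. *)
have ratioE n : (0 < n)%N -> u_ratio F chi0 i j (pair_scale A * (p + q) * n) =
    F i (p * n)%:R / F j (q * n)%:R.
  move=> n0; have n0' : 0 < n%:R :> R by rewrite ltr0n.
  rewrite /chi0; have -> : p%:R / (p + q)%:R = (p * n)%:R / (p * n + q * n)%:R :> R.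
    by rewrite -mulnDl !natrM -mulf_div divff ?mulr1 // gt_eqF.
  apply: pair_pt_ratio => //; first by rewrite -mulnDl muln_gt0 pq0.
  by rewrite -mulnDl mulnA.
have ratio0 n : (0 < n)%N -> 0 <= u_ratio F chi0 i j n.
  move=> n0; have h k : 0 < chi0 k * n%:R by rewrite mulr_gt0 ?ltr0n // hchi0.1.
  by rewrite divr_ge0 // ltW // F0.
have big n : (n <= pair_scale A * (p + q) * n)%N.
  by rewrite leq_pmull // muln_gt0 pair_scale_gt0.
have Fj n : (0 < n)%N -> 0 < F j (q * n)%:R.
  by move=> n0; rewrite F0 // ltr0n muln_gt0 q0.
case: (einf_esup_dichotomy ratio0 (hd chi0 hchi0)) => -[c c0 [n0 hn]].
  left => chi hchi tc; apply: (type_E_loses ij Ei Ej p0 q0 pqt c0 _ hchi tc).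
  exists n0.+1 => n nn; have n1 : (0 < n)%N by exact: leq_ltn_trans nn.
  have := hn _ (leq_trans (ltnW nn) (big n)); rewrite ratioE //.
  by rewrite ler_pdivlMr ?Fj.
right => chi hchi tc.
have qpt : q%:R / p%:R < t^-1.
  by rewrite -[ltLHS]invf_div ltf_pV2 ?posrE // divr_gt0.
have ji : j != i by rewrite eq_sym.
have c0' : 0 < c^-1 by rewrite invr_gt0.
apply: (type_E_loses ji Ej Ei q0 p0 qpt c0' _ hchi); last by rewrite ler_pdivrMl.
exists n0.+1 => n nn; have n1 : (0 < n)%N by exact: leq_ltn_trans nn.
have := hn _ (leq_trans (ltnW nn) (big n)); rewrite ratioE //.
by rewrite ler_pdivrMr ?Fj // ler_pdivrMl.
Qed.

(** By type P the first term is eventually at most the fraction 1 - g of the tail, so the tail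
    decays more slowly than any geometric sequence. *)
Lemma type_P_slow i (g : R) : type_P F i -> g < 1 ->
  exists k0, (0 < k0)%N /\ forall k, (k0 <= k)%N -> g * u_tail F i k <= u_tail F i k.+1.
Proof.
move=> Pi g1; have [hM _] := Pi.
have [k0 hk] := type_P_large (1 - g)^-1 Pi.
exists k0.+1; split=> // k kk; have k1 : (0 < k)%N by exact: leq_trans kk.
have := hk k (ltnW kk); have Fk : 0 < F i k%:R by rewrite F0 ?ltr0n.
rewrite -[leLHS]div1r ler_pdivrMr ?subr_gt0 // => h.
rewrite u_tailS //.
suff : (F i k%:R)^-1 <= (1 - g) * u_tail F i k by lra.
rewrite -[leLHS]div1r ler_pdivrMr //; apply: (le_trans h).
by rewrite le_eqVlt; apply/orP; left; apply/eqP; ring.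
Qed.

Lemma type_E_beats_type_P i j chi : i != j -> type_E F i -> type_P F j ->
  u_simplex_int chi -> loses F j chi.
Proof.
move=> ij Ei Pj hchi; have [hMi _] := Ei; have [hMj _] := Pj.
have [g [g0 g1 [k0 [k00 hg]]]] := type_E_geometric F0 Ei.
apply: (loses_if_tail_negligible F0 A0 ij hMi hMj hchi) => delta d0.
(* [T * k] will bound l: one unit covers the fractional part of [chi j / chi i], the other the
   rounding up of [chi j * N]. *)
pose T := (Num.truncn (chi j / chi i)).+2.
pose h := (1 + g) / 2; have h0 : 0 < h by rewrite /h; lra.
have h1 : h < 1 by rewrite /h; lra.
have gh : g < h by rewrite /h; lra.
have T0 : 0 < T%:R :> R by rewrite ltr0n.
(* By Bernoulli's inequality [e ^+ T >= h > g]. As l <= T k, the tail of j is at least of order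
   [h ^+ k], while that of i is at most of order [g ^+ k]. *)
pose e := 1 - (1 - h) / T%:R.
have hT : (1 - h) / T%:R <= 1 - h.
  by rewrite ler_pdivrMr // ler_peMr ?ler1n // subr_ge0 ltW.
have e0 : 0 < e by rewrite /e; lra.
have e1 : e < 1 by rewrite /e gtrBl divr_gt0 // subr_gt0.
have eT : h <= e ^+ T.
  have bern n : 1 - n%:R * ((1 - h) / T%:R) <= e ^+ n.
    elim: n => [|n IH]; first by rewrite mul0r subr0 expr0.
    rewrite exprS; apply: le_trans (ler_wpM2l (ltW e0) IH).
    rewrite -natr1 /e; set y := (1 - h) / T%:R.
    have y0 : 0 <= y by apply: divr_ge0; [rewrite subr_ge0|]; exact: ltW.
    have : 0 <= n%:R * (y * y) by rewrite mulr_ge0 // mulr_ge0.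
    lra.
  by apply: le_trans (bern T); rewrite mulrCA mulfV ?gt_eqF // mulr1; lra.
have [l0 [l00 hl]] := type_P_slow Pj e1.
have slow n : e ^+ n * u_tail F j l0 <= u_tail F j (l0 + n).
  elim: n => [|n IH]; first by rewrite expr0 mul1r addn0.
  rewrite exprS -mulrA addnS; apply: le_trans (hl _ (leq_addr _ _)).
  by rewrite ler_pM2l.
have Sj0 : 0 < u_tail F j l0 by exact: u_tail_gt0.
have Si0 : 0 < u_tail F i k0 by exact: u_tail_gt0.
have [n1 hn1] : exists n1, forall n, (n1 <= n)%N ->
    (g / h) ^+ n <= delta * u_tail F j l0 * g ^+ k0 / u_tail F i k0.
  have gh1 : `|g / h| < 1.
    by rewrite gtr0_norm; [rewrite ltr_pdivrMr // mul1r | exact: divr_gt0].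
  have dd : 0 < delta * u_tail F j l0 * g ^+ k0 / u_tail F i k0.
    by apply: divr_gt0 => //; apply: mulr_gt0; [exact: mulr_gt0|exact: exprn_gt0].
  have /cvgrPdist_le /(_ _ dd) [n1 _ hn] := cvg_expr gh1.
  exists n1 => n nn; have := hn n nn; rewrite /= sub0r normrN; apply: le_trans.
  exact: ler_norm.
have [N1 hN1] := u_init_large i (k0 + n1 + l0) hchi.
have [N2 hN2] := u_init_large j l0 hchi.
have ci := hchi.1 i; have cj := hchi.1 j.
exists (N1 + N2 + (Num.truncn (chi i)^-1).+1)%N => N NN.
have := hN1 N ltac:(clear -NN; lia); have := hN2 N ltac:(clear -NN; lia).
set k := u_init chi N i; set l := u_init chi N j => hl2 hk2.
have lTk : (l <= T * k)%N.
  rewrite -(ler_nat R) natrM.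
  have /andP[ki _] := u_init_bounds i N hchi; rewrite -/k in ki.
  have /andP[_ /ltW lj] := u_init_bounds j N hchi; rewrite -/l in lj.
  have N3 : 1 <= chi i * N%:R.
    rewrite mulrC -ler_pdivrMr // mul1r; apply: (le_trans (ltW (truncnS_gt _))).
    by rewrite ler_nat; exact: leq_trans (leq_addl _ _) NN.
  have hT2 : chi j / chi i <= (Num.truncn (chi j / chi i)).+1%:R by exact/ltW/truncnS_gt.
  rewrite ler_pdivrMr // in hT2.
  have h3 : chi j * N%:R <= (Num.truncn (chi j / chi i)).+1%:R * (chi i * N%:R).
    by rewrite mulrA ler_wpM2r.
  rewrite /T -natr1 mulrDl mul1r.
  apply: (le_trans lj); apply: lerD; last exact: le_trans ki.
  by apply: (le_trans h3); rewrite ler_pM2l ?ltr0n.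
have -> : u_tail F i k = u_tail F i (k0 + (k - k0)) by rewrite subnKC //; clear -hk2; lia.
apply: (le_trans (hg k0 (k - k0)%N (leqnn _))).
apply: (@le_trans _ _ (delta * (h ^+ k * u_tail F j l0))).
  have := hn1 k ltac:(clear -hk2; lia); rewrite expr_div_n ler_pdivrMr ?exprn_gt0 //.
  rewrite -[in X in X <= _](@subnK k0 k); last by clear -hk2; lia.
  rewrite exprD => hh; rewrite -(ler_pM2r (exprn_gt0 k0 g0)).
  rewrite mulrAC -ler_pdivlMr //; apply: (le_trans hh).
  by rewrite le_eqVlt; apply/orP; left; apply/eqP; field; rewrite gt_eqF.
rewrite ler_pM2l //; have -> : u_tail F j l = u_tail F j (l0 + (l - l0)) by rewrite subnKC.
apply: le_trans (slow _); rewrite ler_pM2r //.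
apply: (@le_trans _ _ (e ^+ (T * k))).
  by rewrite exprM; apply: lerXn2r => //; rewrite nnegrE; [exact: ltW|exact/exprn_ge0/ltW].
apply: ler_wiXn2l; [exact: ltW|exact: ltW|].
by clear -lTk; lia.
Qed.

End DominationTypeE.

(** * Type P agents and the Baire argument *)

Section BaireInterval.
Variable R : realType.
Implicit Types (a b : R).

(** If no [E n] contained an interval inside [a, b], the complements [O n] would be open and dense,
    and by Baire's theorem some point between a and b would lie in no [E n]. *)
Lemma closed_cover_itv a b (E : nat -> set R) : a < b -> (forall n, closed (E n)) ->
  (forall x, a <= x <= b -> exists n, E n x) ->
  exists n c r, 0 < r /\ forall x, `|x - c| < r -> a <= x <= b /\ E n x.
Proof.
move=> ab cE cov; apply: contrapT => none.
pose O n := ~` (E n `&` `[a, b]%classic).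
have oO n : open (O n).
  rewrite /O openC; apply: closedI; first exact: cE.
  exact: (@interval_closed R (BLeft a) (BRight b) isT isT).
have dO n : dense (O n).
  move=> U [c Uc] oU; apply: contrapT => UO; apply: none.
  have /nbhs_ballP[r /= r0 hr] : nbhs c U by exact: open_nbhs_nbhs.
  exists n, c, r; split=> // x xc; apply: contrapT => nx; apply: UO.
  exists x; split; first by apply: hr; rewrite /ball /= distrC.
  by move=> [Ex]; rewrite /= in_itv /= => xab; apply: nx.
have : dense (\bigcap_n O n).
  by apply: (@Baire R R^o) => n; split; [exact: oO|exact: dO].
move=> /(_ `]a, b[%classic).
have ne : `]a, b[%classic !=set0.
  by exists ((a + b) / 2); rewrite /= in_itv /=; apply/andP; split; lra.
move=> /(_ ne (@interval_open _ (BRight a) (BLeft b) isT isT)) [x [xab hx]].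
move: xab; rewrite /= in_itv /= => /andP[/ltW ax /ltW xb].
have [|n Ex] := cov x; first by rewrite ax.
by apply: (hx n I); split=> //=; rewrite in_itv /= ax.
Qed.

Lemma closed_cover_itv2 a b (E G : nat -> set R) : a < b ->
  (forall n, closed (E n)) -> (forall n, closed (G n)) ->
  (forall x, a <= x <= b -> exists n, E n x \/ G n x) ->
  exists n c r, 0 < r /\ ((forall x, `|x - c| < r -> a <= x <= b /\ E n x) \/
    (forall x, `|x - c| < r -> a <= x <= b /\ G n x)).
Proof.
move=> ab cE cG cov.
(* Interleaving by parity reduces the two families to one. *)
pose H n := if odd n then E n./2 else G n./2.
have [|x xab|n [c [r [r0 h]]]] := @closed_cover_itv a b H ab.
- by move=> n; rewrite /H; case: ifP.
- have [n [Ex|Gx]] := cov x xab.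
    by exists n.*2.+1; rewrite /H /= odd_double uphalf_double.
  by exists n.*2; rewrite /H odd_double doubleK.
- by exists n./2, c, r; split=> //; move: h; rewrite /H; case: ifP => _; [left|right].
Qed.

Lemma closed_ge0 (h : R -> R) : continuous h -> closed [set x | 0 <= h x].
Proof.
move=> ch; have -> : [set x | 0 <= h x] = h @^-1` [set y | 0 <= y] by [].
apply: closed_comp; first by move=> x _; exact: ch.
exact: closed_ge.
Qed.

End BaireInterval.

Section DominationTypeP.
Variables (R : realType) (A : nat) (F : feedback R A).
Hypotheses (hF : admissible_feedback F) (A0 : (0 < A)%N).
Implicit Types (i j : 'I_A) (chi : pt R A).

Let F0 : feedback_pos F.
Proof. by move=> i; exact: (hF i).1. Qed.

Lemma feedback_continuous i (x : R) : 0 < x -> {for x, continuous (F i)}.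
Proof.
move=> x0; have [_ [/(_ x x0) [d _] _]] := hF i.
by apply/differentiable_continuous/derivable1_diffP.
Qed.

(** Feedback is controlled only at positive arguments. Clamping x to [a, b] gives a function
    continuous on the whole line, so the Baire argument can use sets closed in [R]. *)
Lemma continuous_clamped i (m a b : R) (l : R -> R) : 0 < m -> continuous l ->
  (forall x, a <= x <= b -> 0 < l x) -> a <= b ->
  continuous (fun x => F i (l (Num.max a (Num.min x b)) * m)).
Proof.
move=> m0 cl lpos ab x.
have hx : a <= Num.max a (Num.min x b) <= b.
  by rewrite le_max lexx /= ge_max ab ge_min lexx orbT.
have cc : {for x, continuous (fun x : R => Num.max a (Num.min x b))}.
  apply: (@continuous_max _ _ (cst a) (fun x : R => Num.min x b)); first exact: cvg_cst.
  by apply: (@continuous_min _ _ id (cst b)); [exact: cvg_id|exact: cvg_cst].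
apply: (@continuous_comp _ _ _ (fun x => l (Num.max a (Num.min x b)) * m) (F i)).
  apply: (@continuousM _ _ (fun x => l (Num.max a (Num.min x b))) (cst m)).
    exact: (@continuous_comp _ _ _ (fun x : R => Num.max a (Num.min x b)) l _ cc (cl _)).
  exact: cvg_cst.
by apply: feedback_continuous; rewrite mulr_gt0 // lpos.
Qed.

(** Since u < v, the limit at each point is below v or above u, so one of the two bounds holds
    eventually. The index from which it holds depends on the point; Baire's theorem makes it uniform
    on an interval. *)
Lemma ratio_dichotomy i j (u v a b : R) : i != j -> 0 < a -> a < b -> b < 1 -> u < v ->
  (forall chi, u_simplex_int chi ->
     exists l : \bar R, (fun N => (u_ratio F chi i j N)%:E) @ \oo --> l) ->
  exists n c r, 0 < r /\
    ((forall x, `|x - c| < r -> a <= x <= b /\ forall N, (n <= N)%N -> (0 < N)%N ->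
       u <= u_ratio F (pair_pt i j x) i j N) \/
     (forall x, `|x - c| < r -> a <= x <= b /\ forall N, (n <= N)%N -> (0 < N)%N ->
       u_ratio F (pair_pt i j x) i j N <= v)).
Proof.
move=> ij a0 ab b1 uv hl.
pose D : R := (pair_scale A)%:R.
have D0 : 0 < D by rewrite ltr0n pair_scale_gt0.
pose cl (x : R) := Num.max a (Num.min x b).
have clE x : a <= x <= b -> cl x = x.
  by move=> /andP[ax xb]; rewrite /cl min_l // max_r.
pose fi N x := F i (cl x * (N%:R / D)).
pose fj N x := F j ((1 - cl x) * (N%:R / D)).
have pos x : a <= x <= b -> 0 < x /\ 0 < 1 - x.
  by move=> /andP[ax xb]; split; [exact: lt_le_trans ax|rewrite subr_gt0; exact: le_lt_trans b1].
have ratioE x N : a <= x <= b -> u_ratio F (pair_pt i j x) i j N = fi N x / fj N x.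
  move=> xab; rewrite /u_ratio /pair_pt eqxx eq_sym (negbTE ij) eqxx /fi /fj clE //.
  by congr (F i _ / F j _); rewrite mulrAC mulrA.
have ND N : (0 < N)%N -> 0 < N%:R / D by move=> N0; apply: divr_gt0; [rewrite ltr0n|].
have fj0 x N : a <= x <= b -> (0 < N)%N -> 0 < fj N x.
  move=> xab N0; apply: F0; rewrite clE // mulr_gt0 ?ND //; exact: (pos x xab).2.
have ci N : (0 < N)%N -> continuous (fi N).
  move=> N0; apply: (@continuous_clamped i (N%:R / D) a b id) => //.
  - exact: ND.
  - by move=> x; exact: cvg_id.
  - by move=> x /pos[].
  - exact: ltW.
have cj N : (0 < N)%N -> continuous (fj N).
  move=> N0; apply: (@continuous_clamped j (N%:R / D) a b (fun x => 1 - x)) => //.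
  - exact: ND.
  - by move=> x; apply: continuousB; [exact: cvg_cst|exact: cvg_id].
  - by move=> x /pos[].
  - exact: ltW.
(* Multiplying by the positive denominator writes both conditions as nonnegativity of continuous
   functions. *)
pose E n := \bigcap_(N in [set N | (n <= N)%N /\ (0 < N)%N]) [set x | 0 <= fi N x - u * fj N x].
pose G n := \bigcap_(N in [set N | (n <= N)%N /\ (0 < N)%N]) [set x | 0 <= v * fj N x - fi N x].
have cE n : closed (E n).
  apply: closed_bigI => N [_ N0]; apply: closed_ge0 => x.
  apply: continuousB; first exact: ci.
  by apply: continuousM; [exact: cvg_cst|exact: cj].
have cG n : closed (G n).
  apply: closed_bigI => N [_ N0]; apply: closed_ge0 => x.
  have c1 : {for x, continuous (fun x => v * fj N x)}.
    by apply: continuousM; [exact: cvg_cst|exact: cj].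
  exact: (continuousB c1 (ci N N0 x)).
have cov x : a <= x <= b -> exists n, E n x \/ G n x.
  move=> xab; have [x0 x1] := pos x xab.
  have [|l ll] := hl (pair_pt i j x).
    by apply: pair_pt_int => //; rewrite x0 -subr_gt0 x1.
  have [esl eil] := cvg_limn_einf_sup ll.
  have [lv|vl] := ltP l v%:E.
    move: eil => e; rewrite -e in lv; have [n hn] := limn_esup_lt lv.
    exists n; right => N [nN N0] /=; have := hn N nN; rewrite lte_fin ratioE //.
    by rewrite ltr_pdivrMr ?fj0 // subr_ge0 => /ltW.
  have ul : (u%:E < l)%E by apply: lt_le_trans vl; rewrite lte_fin.
  rewrite -esl /limn_einf lteNr in ul; have [n hn] := limn_esup_lt ul.
  exists n; left => N [nN N0] /=; have := hn N nN; rewrite lteNr oppeK lte_fin ratioE //.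
  by rewrite ltr_pdivlMr ?fj0 // subr_ge0 => /ltW.
have [n [c [r [r0 h]]]] := closed_cover_itv2 ab cE cG cov.
exists n, c, r; split=> //; case: h => h; [left|right] => x xc; have [xab hx] := h x xc.
  split=> // N nN N0; have := hx N (conj nN N0).
  by rewrite /= subr_ge0 ratioE // ler_pdivlMr ?fj0.
split=> // N nN N0; have := hx N (conj nN N0).
by rewrite /= subr_ge0 ratioE // ler_pdivrMr ?fj0.
Qed.

(** Blocks of p terms of i are matched with blocks of q terms of j. Comparing every pair of terms in
    matched blocks yields the factor p / q, and the sums over blocks telescope to tails. *)
Lemma u_tail_block i j (p q n1 : nat) (u : R) : cond_M F i -> cond_M F j ->
  (0 < p)%N -> (0 < q)%N -> 0 < u ->
  (forall n k l, (n1 <= n)%N -> (p * n <= k < p * n.+1)%N -> (q * n <= l < q * n.+1)%N ->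
     u * F j l%:R <= F i k%:R) ->
  forall n, (n1 < n)%N -> u_tail F i (p * n) <= p%:R / q%:R / u * u_tail F j (q * n).
Proof.
move=> hMi hMj p0 q0 u0 h n nn.
have q0' : 0 < q%:R :> R by rewrite ltr0n.
set C := p%:R / q%:R / u; have C0 : 0 < C by rewrite !divr_gt0 ?ltr0n.
have block m : (n1 < m)%N -> \sum_(p * m <= k < p * m.+1) (F i k%:R)^-1 <=
    C * \sum_(q * m <= l < q * m.+1) (F j l%:R)^-1.
  move=> nm; have m0 : (0 < m)%N by exact: leq_ltn_trans nm.
  have -> : C * \sum_(q * m <= l < q * m.+1) (F j l%:R)^-1 =
      (\sum_(q * m <= l < q * m.+1) (F j l%:R)^-1 / u) *+ p / q%:R.
    by rewrite -mulr_suml -mulr_natr /C; field; rewrite !gt_eqF.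
  rewrite ler_pdivlMr // mulr_natr -sumrMnl.
  have ep : (p * m.+1 - p * m)%N = p by rewrite mulnS addnK.
  have eq : (q * m.+1 - q * m)%N = q by rewrite mulnS addnK.
  rewrite -[X in _ <= _ *+ X]ep -sumr_const_nat; apply: ler_sum_nat => k hk.
  rewrite -[X in _ *+ X]eq -sumr_const_nat; apply: ler_sum_nat => l hl.
  have Fl : 0 < F j l%:R.
    by apply: F0; rewrite ltr0n; case/andP: hl => hl _; apply: leq_trans hl; rewrite muln_gt0 q0.
  rewrite -invfM lef_pV2 ?posrE; first by rewrite mulrC; apply: (h m) => //; exact: ltnW.
    by apply: F0; rewrite ltr0n; case/andP: hk => hk _; apply: leq_trans hk; rewrite muln_gt0 p0.
  by rewrite mulr_gt0.
have tel m : u_tail F i (p * n) - u_tail F i (p * (n + m)) <=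
    C * (u_tail F j (q * n) - u_tail F j (q * (n + m))).
  elim: m => [|m IH]; first by rewrite addn0 !subrr mulr0.
  have := block (n + m)%N (ltn_addr m nn).
  rewrite !u_tail_sum ?leq_mul2l ?leqnSn ?orbT // addnS; lra.
(* The blocks compare differences of tails; the remainder of i at [L] is at most e, and that of j is
   positive and may be dropped. *)
apply/ler_addgt0Pr => e e0.
have [L nL hL] := u_tail_small n hMi e0.
have n0 : (0 < n)%N by exact: leq_ltn_trans nn.
have := tel (L - n)%N; rewrite subnKC //.
have hp : u_tail F i (p * L) <= e.
  apply: le_trans hL; apply: u_tail_le => //; first exact: leq_trans nL.
  by rewrite leq_pmull.
have : 0 < C * u_tail F j (q * L).
  by rewrite mulr_gt0 // u_tail_gt0 // muln_gt0 q0 (leq_trans _ nL).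
lra.
Qed.
(** For all integer points of block n on the ray of slope p / q, k / (k + l) is within 1 / n of p /
    (p + q). With p / (p + q) within r / 2 of c, late blocks fall into the ball of the uniform
    bound. *)
Lemma lattice_in_ball i j (a b c r : R) (n0 : nat) (Q : R -> Prop) : i != j ->
  0 < a -> b < 1 -> 0 < r ->
  (forall x, `|x - c| < r -> a <= x <= b /\ forall N, (n0 <= N)%N -> (0 < N)%N ->
     Q (u_ratio F (pair_pt i j x) i j N)) ->
  exists p q n1, [/\ (0 < p)%N, (0 < q)%N, a <= p%:R / (p + q)%:R <= b &
    forall n k l, (n1 <= n)%N -> (p * n <= k < p * n.+1)%N ->
      (q * n <= l < q * n.+1)%N -> Q (F i k%:R / F j l%:R)].
Proof.
move=> ij a0 b1 r0 h.
have [h1 _] : a <= c - r / 2 <= b /\ _ := h (c - r / 2) ltac:(by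
  rewrite addrAC subrr add0r normrN gtr0_norm; lra).
have c0 : 0 <= c - r / 2 by case/andP: h1 => h1 _; apply: le_trans h1; exact: ltW.
have [p [L [p0 L0 cp pc]]] := @rational_between R (c - r / 2) (c + r / 2) c0 ltac:(lra).
have pLr : `|p%:R / L%:R - c| < r / 2 by rewrite ltr_norml; apply/andP; split; lra.
have L0' : 0 < L%:R :> R by rewrite ltr0n.
have p0' : 0 < p%:R :> R by rewrite ltr0n.
have [pab _] := h (p%:R / L%:R) ltac:(lra).
have pL : (p < L)%N.
  rewrite -(ltr_nat R) -[ltRHS]mul1r -ltr_pdivrMr //; case/andP: pab => _ pb.
  exact: le_lt_trans b1.
have eL : (p + (L - p))%N = L by rewrite subnKC // ltnW.
exists p, (L - p)%N, (n0 + (Num.truncn (2 / r)).+1)%N; split=> //.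
- by rewrite subn_gt0.
- by rewrite eL.
move=> n k l hn hk hl.
have nr : (Num.truncn (2 / r)).+1%:R <= n%:R :> R.
  by rewrite ler_nat; exact: leq_trans (leq_addl _ _) hn.
have nn0 : (n0 <= n)%N by exact: leq_trans (leq_addr _ _) hn.
have n0' : (0 < n)%N by apply: leq_trans hn; rewrite addnS.
have n0R : 0 < n%:R :> R by rewrite ltr0n.
have nr2 : n%:R^-1 < r / 2.
  have : 2 / r < n%:R by apply: lt_le_trans nr; exact: truncnS_gt.
  rewrite ltr_pdivrMr // => hh; rewrite -[ltLHS]mul1r ltr_pdivrMr //.
  by rewrite mulrAC ltr_pdivlMr // mul1r mulrC.
have [pk kp] := andP hk; have [ql lq] := andP hl.
have kl : (L * n <= k + l)%N.
  by rewrite -{1}eL mulnDl leq_add.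
have kl0 : (0 < k + l)%N by apply: leq_trans kl; rewrite muln_gt0 L0.
have kl0' : 0 < (k + l)%:R :> R by rewrite ltr0n.
have diff : `|k%:R / (k + l)%:R - p%:R / L%:R| <= n%:R^-1 :> R.
  have -> : k%:R / (k + l)%:R - p%:R / L%:R =
      (k%:R * L%:R - p%:R * (k + l)%:R) / ((k + l)%:R * L%:R) :> R.
    by field; rewrite -natrD; apply/andP; split; rewrite gt_eqF.
  rewrite normrM normfV [`|_ * L%:R|]gtr0_norm ?mulr_gt0 //.
  rewrite ler_pdivrMr ?mulr_gt0 //.
  apply: (@le_trans _ _ (n%:R^-1 * ((L * n)%:R * L%:R))); last first.
    by rewrite ler_pM2l ?invr_gt0 // ler_pM2r // ler_nat.
  have -> : n%:R^-1 * ((L * n)%:R * L%:R) = L%:R * L%:R :> R.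
    by rewrite natrM; field; rewrite gt_eqF.
  have kR1 : p%:R * n%:R <= k%:R :> R by rewrite -natrM ler_nat.
  have kR2 : k%:R <= p%:R * n%:R + p%:R :> R.
    by rewrite -natrM -natrD ler_nat -mulnSr ltnW.
  have lR1 : (L%:R - p%:R) * n%:R <= l%:R :> R.
    by rewrite -natrB ?(ltnW pL) // -natrM ler_nat.
  have lR2 : l%:R <= (L%:R - p%:R) * n%:R + (L%:R - p%:R) :> R.
    by rewrite -natrB ?(ltnW pL) // -natrM -natrD ler_nat -mulnSr ltnW.
  have pLR : p%:R <= L%:R :> R by rewrite ler_nat ltnW.
  (* Both products on the right lie between 0 and the square of L, which bounds their difference. *)
  have e : k%:R * L%:R - p%:R * (k + l)%:R =
     (k%:R - p%:R * n%:R) * (L%:R - p%:R) - p%:R * (l%:R - (L%:R - p%:R) * n%:R) :> R.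
    by rewrite natrD; ring.
  rewrite e ler_norml; move: kR1 kR2 lR1 lR2 pLR p0' L0'; clear.
  move: (k%:R : R) (l%:R : R) (p%:R : R) (L%:R : R) (n%:R : R) => x y z w v.
  move=> h1 h2 h3 h4 h5 h6 h7.
  have u1 : 0 <= (x - z * v) * (w - z) by apply: mulr_ge0; lra.
  have u2 : (x - z * v) * (w - z) <= z * (w - z) by apply: ler_wpM2r; lra.
  have u3 : 0 <= z * (y - (w - z) * v) by apply: mulr_ge0; lra.
  have u4 : z * (y - (w - z) * v) <= z * (w - z) by apply: ler_wpM2l; lra.
  have u5 : z * (w - z) <= w * w by apply: ler_pM; lra.
  apply/andP; split; lra.
have xc : `|k%:R / (k + l)%:R - c| < r.
  have -> : k%:R / (k + l)%:R - c =
    (k%:R / (k + l)%:R - p%:R / L%:R) + (p%:R / L%:R - c) by ring.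
  by apply: (le_lt_trans (ler_normD _ _)); lra.
have [_ hN] := h _ xc.
rewrite -(@pair_pt_ratio _ _ F i j k l (pair_scale A * (k + l)) ij kl0 erefl).
have kln : (n <= pair_scale A * (k + l))%N.
  apply: (@leq_trans (k + l)); last by rewrite leq_pmull // pair_scale_gt0.
  by apply: leq_trans kl; rewrite leq_pmull.
by apply: hN; [exact: leq_trans kln|exact: leq_trans kln].
Qed.

Lemma type_P_comparison i j (t t' : R) : i != j -> type_P F i -> type_P F j ->
  (forall k, type_P F k ->
     (limn_esup (fun n : nat => ((n%:R)^-1 * F k n%:R * u_tail F k n)%:E) < +oo)%E) ->
  (forall chi, u_simplex_int chi ->
     exists l : \bar R, (fun N => (u_ratio F chi i j N)%:E) @ \oo --> l) ->
  0 < t -> t < t' ->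
  (forall chi, u_simplex_int chi -> t' * chi j <= chi i -> loses F j chi) \/
  (forall chi, u_simplex_int chi -> chi i <= t * chi j -> loses F i chi).
Proof.
move=> ij Pi Pj hP hl t0 tt.
have [hMi _] := Pi; have [hMj _] := Pj.
have [s0 s01 ts0] := exists_factor t0 tt.
(* A factor s of room is needed on either side of the cone, hence the square root of a factor s0
   with [t * s0 < t']. *)
pose s := Num.sqrt s0.
have ss : s * s = s0 by rewrite -expr2 sqr_sqrtr // ltW // (lt_trans ltr01).
have s1 : 1 < s by rewrite /s -[ltLHS]sqrtr1 ltr_sqrt // (lt_trans ltr01).
have spos : 0 < s by exact: lt_trans s1.
have [ri [ri0 ri1 gi]] := type_P_gap F0 hMi (hP i Pi) s1.
have [rj [rj0 rj1 gj]] := type_P_gap F0 hMj (hP j Pj) s1.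
pose w0 := (s * t + t' / s) / 2.
have st : s * t < t' / s by rewrite ltr_pdivlMr // mulrAC ss mulrC.
have tw : s * t < w0 by rewrite /w0; lra.
have wt : w0 < t' / s by rewrite /w0; lra.
have w00 : 0 < w0 by apply: lt_trans tw; exact: mulr_gt0.
have [k1 k11 wk1] := exists_factor w00 wt.
have [k2 k21 rk2] := exists_factor ri0 ri1.
have [k3 k31 rk3] := exists_factor rj0 rj1.
(* The cone has slopes from [w0] to [w0 * kp]. The block comparison loses at most the factor kp,
   small enough that [kp * ri] and [kp * rj] stay below 1. *)
pose kp := Num.min k1 (Num.min k2 k3).
have kp1 : 1 < kp by rewrite !lt_min k11 k21 k31.
have kpk1 : kp <= k1 by rewrite ge_min lexx.
have kpk2 : kp <= k2 by rewrite !ge_min lexx orbT.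
have kpk3 : kp <= k3 by rewrite !ge_min lexx !orbT.
have kp0 : 0 < kp by exact: lt_trans kp1.
pose w1 := w0 * kp.
have w01 : w0 < w1 by rewrite /w1 ltr_pMr.
have w10 : 0 < w1 by exact: lt_trans w01.
have w1t : w1 * s < t'.
  rewrite -ltr_pdivlMr //; apply: le_lt_trans wk1.
  by rewrite /w1 ler_pM2l.
have rik : kp * ri < 1 by apply: le_lt_trans rk2; rewrite mulrC ler_pM2l.
have rjk : kp * rj < 1 by apply: le_lt_trans rk3; rewrite mulrC ler_pM2l.
(* Proportions p / (p + q) from a to b correspond to slopes p / q from w0 to w1. *)
pose a := w0 / (1 + w0); pose b := w1 / (1 + w1).
have a1 : 0 < 1 + w0 by rewrite addr_gt0.
have b1 : 0 < 1 + w1 by rewrite addr_gt0.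
have a0 : 0 < a by rewrite divr_gt0.
have b11 : b < 1 by rewrite ltr_pdivrMr // mul1r ltrDr.
have ab : a < b by rewrite ltr_pdivrMr // mulrAC ltr_pdivlMr //; lra.
have range (p q : nat) : (0 < p)%N -> (0 < q)%N -> a <= p%:R / (p + q)%:R <= b ->
    w0 <= p%:R / q%:R <= w1.
  move=> p0 q0; have p0' : 0 < p%:R :> R by rewrite ltr0n.
  have q0' : 0 < q%:R :> R by rewrite ltr0n.
  rewrite natrD ler_pdivlMr ?addr_gt0 // ler_pdivrMr ?addr_gt0 //.
  have ea : a * (1 + w0) = w0 by rewrite /a divfK // gt_eqF.
  have eb : b * (1 + w1) = w1 by rewrite /b divfK // gt_eqF.
  move=> /andP[/(ler_wpM2r (ltW a1)) h1 /(ler_wpM2r (ltW b1)) h2].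
  rewrite mulrAC ea in h1; rewrite [leRHS]mulrAC eb in h2.
  by rewrite ler_pdivlMr // ler_pdivrMr //; apply/andP; split; lra.
have Fpos k (n : nat) : (0 < n)%N -> 0 < F k n%:R by move=> n0; rewrite F0 ?ltr0n.
have [n0 [c [r [r0 [h|h]]]]] := ratio_dichotomy ij a0 ab b11 w01 hl.
  left => chi hchi tc.
  have [p [q [n1 [p0 q0 /(range _ _ p0 q0) /andP[wp pw] hb]]]] :=
    @lattice_in_ball i j a b c r n0 (fun y => w0 <= y) ij a0 b11 r0 h.
  have blk : forall n, (n1.+1 < n)%N ->
      u_tail F i (p * n) <= p%:R / q%:R / w0 * u_tail F j (q * n).
    apply: u_tail_block => // n k l nn hk hl'.
    have l0 : (0 < l)%N.
      by case/andP: hl' => hl' _; apply: leq_trans hl'; rewrite muln_gt0 q0 (leq_ltn_trans _ nn).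
    by rewrite -ler_pdivlMr ?Fpos //; apply: (hb n) => //; exact: ltnW.
  have kpe : p%:R / q%:R / w0 <= kp by rewrite ler_pdivrMr // [leRHS]mulrC.
  have bb : exists n2, forall n, (n2 <= n)%N -> u_tail F i (p * n) <= kp * u_tail F j (q * n).
    exists n1.+2 => n nn; apply: (le_trans (blk n nn)).
    rewrite ler_pM2r // u_tail_gt0 // muln_gt0 q0 //; exact: leq_ltn_trans nn.
  have pqs : p%:R / q%:R * s < t' by apply: le_lt_trans w1t; rewrite ler_pM2r.
  apply: (loses_if_type_P F0 A0 ij Pi Pj hchi rjk).
  exact: (tail_transfer F0 hMi hMj p0 q0 (ltW kp0) s1 pqs bb gj hchi tc).
right => chi hchi tc; have ji : j != i by rewrite eq_sym.
have [p [q [n1 [p0 q0 /(range _ _ p0 q0) /andP[wp pw] hb]]]] :=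
  @lattice_in_ball i j a b c r n0 (fun y => y <= w1) ij a0 b11 r0 h.
have p0' : 0 < p%:R :> R by rewrite ltr0n.
have q0' : 0 < q%:R :> R by rewrite ltr0n.
have blk : forall n, (n1.+1 < n)%N ->
    u_tail F j (q * n) <= q%:R / p%:R / w1^-1 * u_tail F i (p * n).
  apply: u_tail_block => //; first by rewrite invr_gt0.
  move=> n l k nn hl' hk.
  have l0 : (0 < l)%N.
    by case/andP: hl' => hl' _; apply: leq_trans hl'; rewrite muln_gt0 q0 (leq_ltn_trans _ nn).
  by rewrite ler_pdivrMl // -ler_pdivrMr ?Fpos //; apply: (hb n) => //; exact: ltnW.
have kpe : q%:R / p%:R / w1^-1 <= kp.
  rewrite invrK mulrAC ler_pdivrMr //.
  move: wp; rewrite ler_pdivlMr // => wp; rewrite /w1.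
  have := ler_wpM2l (ltW kp0) wp; lra.
have bb : exists n2, forall n, (n2 <= n)%N -> u_tail F j (q * n) <= kp * u_tail F i (p * n).
  exists n1.+2 => n nn; apply: (le_trans (blk n nn)).
  rewrite ler_pM2r // u_tail_gt0 // muln_gt0 p0 //; exact: leq_ltn_trans nn.
have pqs : q%:R / p%:R * s < t^-1.
  rewrite -ltr_pdivlMr // -invfM -[ltLHS]invf_div ltf_pV2 ?posrE ?divr_gt0 ?mulr_gt0 //.
  by rewrite mulrC; exact: lt_le_trans wp.
apply: (loses_if_type_P F0 A0 ji Pj Pi hchi rik).
apply: (tail_transfer F0 hMj hMi q0 p0 (ltW kp0) s1 pqs bb gi hchi).
by rewrite ler_pdivrMl.
Qed.

End DominationTypeP.

(** * Dissection of the simplex *)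

Lemma exists_nonroot (R : realFieldType) (p : {poly R}) (d : R) : p != 0 -> 0 < d ->
  exists2 e, 0 < e < d & p.[e] != 0.
Proof.
move=> p0 d0; apply: contrapT => none.
pose rs := [seq d / k.+2%:R | k <- iota 0 (size p)].
have urs : uniq rs.
  rewrite map_inj_uniq ?iota_uniq // => k l /(mulfI (lt0r_neq0 d0)) /invr_inj /eqP.
  by rewrite eqr_nat => /eqP[].
have ars : all (root p) rs.
  apply/allP => _ /mapP[k _ ->]; apply/negPn/negP => nr; apply: none.
  exists (d / k.+2%:R) => //; rewrite divr_gt0 //= ltr_pdivrMr //.
  by rewrite ltr_pMr // ltr1n.
by have := max_poly_roots p0 ars urs; rewrite size_map size_iota ltnn.
Qed.

Section Dissection.
Variables (R : realType) (A : nat).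
Implicit Types (i j : 'I_A) (chi : pt R A).

(** Along the curve [x i + h ^+ i.+1], normalised, each relation [y i = s i j * y j] becomes a
    nonzero polynomial equation in h; a small h that is no root of their product avoids them all. *)
Lemma generic_point (s : 'I_A -> 'I_A -> R) (x : pt R A) (e : R) : u_simplex x -> 0 < e ->
  exists y, [/\ u_simplex_int y, u_close x y e & forall i j, i != j -> y i != s i j * y j].
Proof.
move=> [x0 x1] e0.
pose q i : {poly R} := (x i)%:P + 'X^(i.+1).
pose p := \prod_(ij : 'I_A * 'I_A | ij.1 != ij.2) (q ij.1 - s ij.1 ij.2 *: q ij.2).
have p0 : p != 0.
  (* Of [q i] and [q j] only [q i] contains the monomial of degree i + 1, and with coefficient 1. *)
  apply/prodf_neq0 => -[i j] /= ij; apply/eqP => /(congr1 (fun r : {poly R} => r`_i.+1)).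
  rewrite coef0 coefB coefZ !coefD !coefC !coefXn /= eqxx eqSS.
  rewrite (negbTE (_ : (i : nat) != j)) ?addr0 ?add0r ?mulr0 ?subr0; last first.
    by apply: contra ij => /eqP/val_inj ->.
  by move/eqP; rewrite oner_eq0.
have AA0 : 0 < (A.+1)%:R :> R by rewrite ltr0n.
have d0 : 0 < Num.min 1 (e / A.+1%:R) by rewrite lt_min ltr01 divr_gt0.
have [h /andP[h0 hd] hp] := exists_nonroot p0 d0.
move: hd; rewrite lt_min => /andP[h1 he].
have qE i : (q i).[h] = x i + h ^+ i.+1 by rewrite !hornerE.
have hpow i : 0 < h ^+ i.+1 <= h.
  rewrite exprn_gt0 //= -[leRHS]expr1; apply: ler_wiXn2l => //; exact: ltW.
pose T := \sum_(i < A) (q i).[h].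
pose W := \sum_(i < A) h ^+ (nat_of_ord i).+1.
have W0 : 0 <= W by apply: sumr_ge0 => i _; have /andP[/ltW] := hpow i.
have WA : W <= h *+ A.
  rewrite -[X in _ *+ X](card_ord A) -sumr_const; apply: ler_sum => i _.
  by have /andP[] := hpow i.
have TW : T = 1 + W by rewrite /T; under eq_bigr do rewrite qE; rewrite big_split /= x1.
have T0 : 0 < T by rewrite TW ltr_pwDl.
have qpos i : 0 < (q i).[h] by rewrite qE ltr_wpDl //; have /andP[] := hpow i.
exists (fun i => (q i).[h] / T); split.
- split=> [i|]; first exact: divr_gt0.
  by rewrite -mulr_suml divff // gt_eqF.
- move=> i; have -> : (q i).[h] / T - x i = (h ^+ i.+1 - x i * W) / T.
    by rewrite TW qE; field; rewrite -TW gt_eqF.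
  rewrite normrM normfV (gtr0_norm T0) ltr_pdivrMr //.
  have xi1 : x i <= 1 by rewrite -x1 (bigD1 i) //= lerDl sumr_ge0.
  have xW : x i * W <= W by rewrite ler_piMl.
  have xW0 : 0 <= x i * W by rewrite mulr_ge0.
  have /andP[hi0 hih] := hpow i.
  have hA : h * A.+1%:R < e by rewrite -ltr_pdivlMr.
  rewrite mulr_natr mulrS in hA.
  have eT : e <= e * T by rewrite TW ler_peMr ?lerDl // ltW.
  apply: lt_le_trans eT; apply: le_lt_trans hA.
  by rewrite ler_norml; apply/andP; split; lra.
- move=> i j ij; apply: contra hp => /eqP hij; rewrite horner_prod.
  rewrite (bigD1 (i, j)) //= hornerD hornerN hornerZ mulf_eq0; apply/orP; left.
  rewrite subr_eq0 -(inj_eq (mulIf (lt0r_neq0 (_ : 0 < T^-1)))) ?invr_gt0 //.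
  by rewrite hij mulrA.
Qed.

Variable F : feedback R A.
Hypotheses (F0 : feedback_pos F) (A0 : (0 < A)%N).

Definition threshold i j (s : R) := forall chi, u_simplex_int chi ->
  (s * chi j < chi i -> loses F j chi) /\ (chi i < s * chi j -> loses F i chi).

(** The critical ratio is the infimum of the slopes above which j loses. Below it no slope
    qualifies, so the comparison makes i lose there; if no slope qualifies at all, i loses
    everywhere. *)
Lemma threshold_exists i j :
  (forall t t' : R, 0 < t -> t < t' ->
    (forall chi, u_simplex_int chi -> t' * chi j <= chi i -> loses F j chi) \/
    (forall chi, u_simplex_int chi -> chi i <= t * chi j -> loses F i chi)) ->
  (exists2 s, 0 <= s & threshold i j s) \/ (forall chi, u_simplex_int chi -> loses F i chi).
Proof.
move=> h.
pose W := [set t : R | 0 < t /\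
  forall chi, u_simplex_int chi -> t * chi j <= chi i -> loses F j chi].
have [W0|/set0P/negP/negPn/eqP W0] := pselect (W !=set0); last first.
  right => chi hchi; have ci := hchi.1 i; have cj := hchi.1 j.
  have r0 : 0 < chi i / chi j by rewrite divr_gt0.
  have [hl|] := h _ (chi i / chi j + 1) r0 ltac:(rewrite ltrDl; exact: ltr01).
    have : W (chi i / chi j + 1) by split=> //; exact: addr_gt0.
    by rewrite W0.
  by apply => //; rewrite divfK // gt_eqF.
have lbW : lbound W 0 by move=> t [/ltW].
have hi : has_inf W by split=> //; exists 0.
left; exists (inf W); first exact: lb_le_inf.
move=> chi hchi; have ci := hchi.1 i; have cj := hchi.1 j; split=> hs.
  have : inf W < chi i / chi j by rewrite ltr_pdivlMr.
  move=> /(inf_lt W0)[t [t0 ht] tc].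
  by apply: ht => //; rewrite -ler_pdivlMr // ltW.
have r0 : 0 < chi i / chi j by rewrite divr_gt0.
have rs : chi i / chi j < inf W by rewrite ltr_pdivrMr.
have [hl|] := h _ ((chi i / chi j + inf W) / 2) r0 ltac:(lra).
  have /(ge_inf hi.2) : W ((chi i / chi j + inf W) / 2) by split=> //; lra.
  by lra.
by apply => //; rewrite divfK // gt_eqF.
Qed.

Lemma threshold_dissection :
  (forall i j, i != j ->
    (exists2 s, 0 <= s & threshold i j s) \/
    (forall chi, u_simplex_int chi -> loses F i chi)) ->
  (forall i, polytope_up_to_boundary (attraction_domain F i)) /\
  (forall x : pt R A, u_simplex x <->
     exists i, closure_in_simplex (attraction_domain F i) x).
Proof.
move=> hthr; have dom i chi : attraction_domain F i chi -> ~ loses F i chi.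
  by move=> di li; exact: (loses_attraction_domain F0 A0 li di).
split=> [i|x]; last first.
  split=> [hx|[i []] //].
  (* If distinct agents i and j have no threshold, i loses everywhere and is not the surviving agent
     chosen below, so the default 0 is harmless. *)
  pose s i j : R := if pselect (exists s, threshold i j s) is left e then sval (cid e) else 0.
  apply: contrapT => /forallNP none.
  have /choice[f hf] : forall i, exists e : R, 0 < e /\
      forall y, attraction_domain F i y -> ~ u_close x y e.
    move=> i; apply: contrapT => ne; apply: (none i); split=> // e e0.
    apply: contrapT => nex; apply: ne; exists e; split=> // y dy cy.
    by apply: nex; exists y.
  pose e := \big[Num.min/1]_(i < A) f i.
  have e0 : 0 < e by apply: lt_bigmin => // i _; exact: (hf i).1.
  have [y [hy xy gy]] := generic_point s hx e0.
  have [i li] := exists_not_loses F0 A0 hy.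
  apply: ((hf i).2 y) => [|j]; last first.
    by apply: lt_le_trans (xy j) _; apply: bigmin_le_cond.
  apply: (attraction_domain_if A0 hy) => j ji.
  have ij : i != j by rewrite eq_sym.
  have [[r _ thr]|/(_ y hy)//] := hthr i j ij.
  have : threshold i j (s i j).
    by rewrite /s; case: pselect => [ex|ne]; [exact: (svalP (cid ex))|case: ne; exists r].
  move=> /(_ y hy)[up down].
  case: (ltgtP (y i) (s i j * y j)) => [/down|/up|yi] //.
  by have := gy i j ij; rewrite yi eqxx.
have [[j ij al]|nal] := pselect (exists2 j, i != j & forall chi, u_simplex_int chi -> loses F i chi).
  (* The domain is empty here, and the constraint [0 <= -1] describes the empty polytope. *)
  exists 1%N, (fun _ _ => 0), (fun=> -1); split=> [x _ [[_ /(_ ord0)]]|x dx].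
    by rewrite big1 => [|k _]; rewrite ?mul0r // lerNr oppr0 ler10.
  by case: (dom i x dx); apply: al; exact: dx.1.
have /choice[s hs] : forall j, exists s : R, i != j -> 0 <= s /\ threshold i j s.
  move=> j; have [->|ij] := eqVneq i j; first by exists 0.
  have [[s s0 thr]|al] := hthr i j ij; first by exists s.
  by case: nal; exists j.
(* Row k encodes [s k * x k <= x i]; row i is the void constraint [0 <= 0]. *)
pose a (k : 'I_A) : pt R A := fun l =>
  if i == k then 0 else (if l == k then s k else 0) - (if l == i then 1 else 0).
have aE k x : i != k -> \sum_(l < A) a k l * x l = s k * x k - x i.
  move=> ik; rewrite /a (negbTE ik).
  under eq_bigr do rewrite mulrBl.
  rewrite sumrB (bigD1 k) //= eqxx big1 ?addr0; last first.
    by move=> l /negbTE ->; rewrite mul0r.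
  congr (_ - _); rewrite (bigD1 i) //= eqxx mul1r big1 ?addr0 //.
  by move=> l /negbTE ->; rewrite mul0r.
exists A, a, (fun=> 0); split=> [x hx [_ [e e0 hQ]]|x dx].
  apply: (attraction_domain_if A0 hx) => k; rewrite eq_sym => ik.
  have [s0 thr] := hs k ik; apply: (thr x hx).1.
  (* Shifting mass h from i to k stays inside the polytope, which turns the weak inequality into the
     strict one that the threshold requires at x. *)
  pose h := Num.min (e / 2) (x i / 2).
  have xi := hx.1 i; have xk := hx.1 k.
  have h0 : 0 < h by rewrite lt_min !divr_gt0.
  have he : h < e by rewrite gt_min; apply/orP; left; lra.
  have hxi : h < x i by rewrite gt_min; apply/orP; right; lra.
  pose y : pt R A := fun l => x l + ((if l == k then h else 0) - (if l == i then h else 0)).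
  have yk : y k = x k + h by rewrite /y eqxx [k == i]eq_sym (negbTE ik) subr0.
  have yi : y i = x i - h by rewrite /y eqxx (negbTE ik) add0r.
  have [_ /(_ k)] : u_polytope a (fun=> 0) y.
    apply: hQ.
      split=> [l|].
        rewrite /y; have := hx.1 l; have [->|lk] := eqVneq l k.
          by rewrite [k == i]eq_sym (negbTE ik); lra.
        by have [->|_] := eqVneq l i; lra.
      rewrite big_split /= hx.2 sumrB (bigD1 k) //= eqxx big1 ?addr0; last first.
        by move=> l /negbTE ->.
      rewrite (bigD1 i) //= eqxx big1 ?addr0; last by move=> l /negbTE ->.
      by rewrite subrr addr0.
    move=> l; rewrite /y addrC addKr; have [->|lk] := eqVneq l k.
      by rewrite [k == i]eq_sym (negbTE ik) subr0 gtr0_norm.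
    by have [_|_] := eqVneq l i; rewrite sub0r normrN ?normr0 // gtr0_norm.
  rewrite aE // yk yi => hh; have : 0 <= s k * h by rewrite mulr_ge0 // ltW.
  lra.
have hx := dx.1; split; first by split=> [j|]; [exact/ltW/hx.1|exact: hx.2].
move=> k; have [ik|ik] := eqVneq i k.
  by rewrite big1 // => l _; rewrite /a ik eqxx mul0r.
rewrite aE // leNgt; apply/negP => hlt; apply: (dom i x dx).
by apply: ((hs k ik).2 x hx).2; lra.
Qed.

End Dissection.

Theorem mainTheorem8 (R : realType) (A : nat) (hA : (2 <= A)%N) (F : feedback R A)
  (hF : admissible_feedback F)
  (hM : exists i : 'I_A, cond_M F i)
  (hPE : forall i : 'I_A, cond_M F i -> type_P F i \/ type_E F i)
  (hcase :
     ((exists i : 'I_A, type_E F i) /\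
      (forall (chi : pt R A) (i j : 'I_A), u_simplex_int chi ->
         ~ (limn_einf (fun N => (u_ratio F chi i j N)%:E) = 0%E /\
            limn_esup (fun N => (u_ratio F chi i j N)%:E) = +oo%E)))
     \/
     ((forall i : 'I_A, ~ type_E F i) /\
      (forall i : 'I_A, type_P F i ->
         (limn_esup (fun k : nat => ((k%:R)^-1 * F i k%:R * u_tail F i k)%:E) < +oo)%E) /\
      (forall (chi : pt R A) (i j : 'I_A), u_simplex_int chi ->
         exists l : \bar R, (fun N => (u_ratio F chi i j N)%:E) @ \oo --> l))) :
  (forall i : 'I_A, polytope_up_to_boundary (attraction_domain F i)) /\
  (forall x : pt R A, u_simplex x <-> exists i : 'I_A, closure_in_simplex (attraction_domain F i) x) /\
  (forall i j : 'I_A, i != j -> attraction_domain F i `&` attraction_domain F j = set0) /\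
  (forall i : 'I_A, ~ cond_M F i -> attraction_domain F i = set0).
Proof.
have A0 : (0 < A)%N by exact: leq_trans hA.
have F0 : feedback_pos F by move=> i; exact: (hF i).1.
have [m Mm] := hM.
have nM i chi : ~ cond_M F i -> u_simplex_int chi -> loses F i chi.
  move=> ni hchi; have mi : m != i by apply/eqP => mi; apply: ni; rewrite -mi.
  exact: (loses_if_not_cond_M F0 A0 mi Mm ni hchi).
(* [Act] singles out the agents not excluded outright: those of type E in the first case, all those
   with (M) in the second. *)
have [Act [hAct hcmp]] : exists Act : 'I_A -> Prop,
    (forall i, ~ Act i -> forall chi : pt R A, u_simplex_int chi -> loses F i chi) /\
    (forall i j, i != j -> Act i -> Act j -> forall t t' : R, 0 < t -> t < t' ->
      (forall chi, u_simplex_int chi -> t' * chi j <= chi i -> loses F j chi) \/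
      (forall chi, u_simplex_int chi -> chi i <= t * chi j -> loses F i chi)).
  case: hcase => [[[e Ee] hE]|[nE [hP hl]]].
    exists (type_E F); split=> [i nE chi hchi|i j ij Ei Ej t t' t0 tt]; last first.
      by apply: (type_E_comparison F0 A0 ij Ei Ej) => // chi; exact: hE.
    have [Mi|/nM] := pselect (cond_M F i); last exact.
    have ei : e != i by apply/eqP => ei; apply: nE; rewrite -ei.
    by case: (hPE i Mi) => // Pi; exact: (type_E_beats_type_P F0 A0 ei Ee Pi hchi).
  exists (cond_M F); split=> [i /nM|i j ij Mi Mj t t' t0 tt]; first exact.
  have type_of k : cond_M F k -> type_P F k by move=> /hPE[] // /nE.
  by apply: (type_P_comparison hF A0 ij (type_of i Mi) (type_of j Mj) hP) => // chi; exact: hl.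
have [hpoly hcover] : (forall i, polytope_up_to_boundary (attraction_domain F i)) /\
    (forall x : pt R A, u_simplex x <->
       exists i, closure_in_simplex (attraction_domain F i) x).
  apply: (threshold_dissection F0 A0) => i j ij.
  have [Ai|/hAct al] := pselect (Act i); last by right.
  have [Aj|/hAct al] := pselect (Act j).
    by apply: threshold_exists; exact: hcmp.
  (* An inactive j loses everywhere, so 0 serves as critical ratio: no coordinate of an interior
     point lies below it. *)
  left; exists 0 => // chi hchi; rewrite mul0r; split=> [_|]; first exact: al.
  by rewrite ltNge ltW // hchi.1.
split=> //; split=> //; split=> [i j|i ni]; first exact: attraction_domain_disjoint.
apply/seteqP; split=> // chi di.
exact: (loses_attraction_domain F0 A0 (nM i chi ni di.1) di).
Qed.
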